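(* The pricing query complexity of learning the CDF of a regular distribution supported on $[0,1]$ within Lévy distance $\epsilon$ is $\tilde{O}(\epsilon^{-5/2})$: there is an algorithm that, for every regular distribution $F$ on $[0,1]$, uses $\tilde{O}(\epsilon^{-5/2})$ pricing queries and outputs $\hat F$ with $\mathrm{L\acute{e}vy}(F,\hat F)\le\epsilon$ with high probability. This is tight up to polylogarithmic factors, i.e. $\Omega(\epsilon^{-5/2})$ pricing queries are necessary.
   Context: A distribution with CDF $F$ is regular if $R(q)=qF^{-1}(1-q)$ is concave on $[0,1]$. Pricing query model: in each round $t$ the algorithm (adaptively) chooses a price $p_t$, a fresh sample $v_t\sim F$ is drawn independently, and the algorithm observes only $\mathrm{sign}(v_t-p_t)\in\{-1,+1\}$. Lévy distance: $\mathrm{L\acute{e}vy}(F,G)=\inf\{\epsilon: F(v-\epsilon)-\epsilon\le G(v)\le F(v+\epsilon)+\epsilon\ \forall v\}$. $\tilde{O}$ hides polylog$(1/\epsilon)$ factors. *)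

(* Defs.v *)
From HB Require Import structures.
From mathcomp Require Import all_boot all_order all_algebra.
From mathcomp Require Import all_classical all_reals all_analysis.
From mathcomp Require Import measurable_realfun.
Set Implicit Arguments. Unset Strict Implicit. Unset Printing Implicit Defensive.
Import Order.TTheory GRing.Theory Num.Theory.
Import numFieldNormedType.Exports.
Local Open Scope classical_set_scope.
Local Open Scope ring_scope.

Definition cdf_of (R : realType) (mu : probability R R) : R -> R :=
  fun x => fine (mu [set` `]-oo, x]]).

Definition supported01 (R : realType) (mu : probability R R) : Prop :=
  mu [set` `[0%R, 1%R]] = 1%E.

(* Generalized inverse of a CDF of a distribution supported on [0,1]:
   F^{-1}(u) = inf { v in [0,1] | F v >= u }.  For u in (0,1] this is the
   usual quantile inf { v | F v >= u }; for u = 0 it gives 0. *)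
Definition quantile (R : realType) (F : R -> R) (u : R) : R :=
  inf [set v : R | 0 <= v <= 1 /\ u <= F v].

Definition revenue (R : realType) (F : R -> R) (q : R) : R :=
  q * quantile F (1 - q).

Definition regular (R : realType) (F : R -> R) : Prop :=
  forall q1 q2 t : R, 0 <= q1 <= 1 -> 0 <= q2 <= 1 -> 0 <= t <= 1 ->
    t * revenue F q1 + (1 - t) * revenue F q2
      <= revenue F (t * q1 + (1 - t) * q2).

(* Levy distance, as an extended real (inf of the empty set is +oo). *)
Definition levy (R : realType) (F G : R -> R) : \bar R :=
  ereal_inf [set e%:E | e in [set e : R |
     forall v, F (v - e) - e <= G v /\ G v <= F (v + e) + e]].

(* Pricing query: observation true (= sign +1) iff v >= p, false (= -1) iff v < p.
   Probability of observing b at price p. *)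
Definition obs_prob (R : realType) (mu : probability R R) (b : bool) (p : R) : R :=
  if b then fine (mu [set` `[p, +oo[]) else fine (mu [set` `]-oo, p[]).

(* A deterministic adaptive algorithm making n pricing queries: the price of
   query i is [price h] where h (of size i) is the history of past
   observations; after n queries it outputs the estimate [out h] (a function
   R -> R).  Probability over the fresh i.i.d. samples v_1..v_n ~ mu that the
   output is within Levy distance eps of the true CDF. *)
Definition det_success (R : realType) (n : nat) (price : seq bool -> R)
    (out : seq bool -> R -> R) (mu : probability R R) (eps : R) : R :=
  \sum_(b : n.-tuple bool)
     (\prod_(i < n) obs_prob mu (tnth b i) (price (take i b)))
       * ((levy (cdf_of mu) (out b) <= eps%:E)%E)%:R.

(* A randomized algorithm: internal randomness w drawn from a probability
   space (Omega, P); given w, it behaves as the deterministic algorithm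
   (price w, out w).  Success probability. *)
Definition success (R : realType) d (Omega : measurableType d)
    (P : probability Omega R) (n : nat) (price : Omega -> seq bool -> R)
    (out : Omega -> seq bool -> R -> R) (mu : probability R R) (eps : R) : \bar R :=
  (\int[P]_w (det_success n (price w) (out w) mu eps)%:E)%E.

Definition measurable_alg (R : realType) d (Omega : measurableType d)
    (n : nat) (price : Omega -> seq bool -> R)
    (out : Omega -> seq bool -> R -> R) : Prop :=
  forall (mu : probability R R) (eps : R),
    measurable_fun [set: Omega] ((fun w => (det_success n (price w) (out w) mu eps)%:E) : Omega -> \bar R).

(* Main.v *)
(* Write S(v) = P(V >= v).  Regularity of F means that 1/S is convex where S > 0.

   Upper bound.  S is learnt on a grid of step about eps by a noisy bisection: every
   visited point is queried about eps^-2 log(1/eps) times, and an interval is halved as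
   long as S drops by a factor 2 on it or its middle value exceeds the harmonic mean of
   its end values by a multiple of eps.  An interval that is not halved determines S up to
   O(eps) by convexity.  On the intervals of one level that are halved, y = 1/S satisfies
   a discrete version of y'' >= c eps y^2 with y >= 1, and y <= O(1/eps) then allows only
   O(eps^(-1/2) log(1/eps)) of them.  The output is any regular CDF compatible with the
   estimates.

   Lower bound.  With g = 1/S = 1 + v + v^2 as base, replacing g by its chord on one of
   about eps^(-1/2) disjoint windows of width w = 25 eps^(1/2) keeps g convex and moves F
   by more than the Levy distance tolerates, while changing the answer probabilities by
   O(eps) inside that window only.  With n queries, on average a window receives
   O(n eps^(1/2)) of them, and fewer than order eps^-2 queries in the window cannot
   distinguish the perturbed distribution from the base. *)

Require Import Defs.
From HB Require Import structures.
From mathcomp Require Import all_boot all_order all_algebra.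
From mathcomp Require Import all_classical all_reals all_analysis.
From mathcomp Require Import measurable_realfun.
From mathcomp Require Import ring lra.
Import Order.TTheory GRing.Theory Num.Theory.
Import numFieldNormedType.Exports.
Local Open Scope classical_set_scope.
Local Open Scope ring_scope.
Set Implicit Arguments.
Unset Strict Implicit.
Arguments obs_prob : simpl never.

(** * Noisy bisection for functions with convex reciprocal *)

(** The upper bound rests on uniqueness rather than on reconstruction: two regular distributions
    that both agree with the recorded estimates differ by at most 216 t on the grid, so any
    compatible one may be returned. The comparison is one-sided and is used twice with the roles
    exchanged. The number of rounds is bounded through a property of the true S, [curved], in which
    the answers do not occur; hence adaptivity of the queries does no harm. S is taken as P(V >= v),
    the probability of a positive answer, because atoms are possible (the hard distributions have
    one at 1).

    In the lower bound the obstacle is that the rarely visited window depends on the algorithm and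
    on its internal randomness. The sum of the success probabilities over all windows is therefore
    bounded for each outcome of this randomness and integrated afterwards. For this the information
    bound has to be linear in the expected number of hits of a window. *)

Definition potential (R : realType) (sg y f : R) : R :=
  2 * ln y + Num.min (f / (sg * y)) 1.

Lemma ln_ge_1BV (R : realType) (x : R) : 0 < x -> 1 - x^-1 <= ln x.
Proof.
move=> x0; rewrite -[X in ln X]invrK lnV ?posrE ?invr_gt0//.
have := @le_ln1Dx R (x^-1 - 1); rewrite addrCA subrr addr0 => H.
have : 0 < x^-1 by rewrite invr_gt0.
move=> V; have := H _; lra.
Qed.

Lemma ln_le_subr1 (R : realType) (x : R) : 0 < x -> ln x <= x - 1.
Proof.
by move=> x0; have := @le_ln1Dx R (x - 1); rewrite addrCA subrr addr0; apply; lra.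
Qed.

(** Raising y divides the slope ratio f/(sg y) by y'/y. As the ratio is capped at 1, this loses at
    most 1 - y/y' <= ln (y'/y), which one of the two logarithms in [potential] pays for; the other
    one is the net gain. *)
Lemma potential_gain (R : realType) (sg y y' f f' d : R) :
  0 < sg -> 0 < y -> y <= y' -> 0 <= f -> 0 <= d -> f + sg * d * y <= f' ->
  potential sg y f + ln (y' / y)
    + (Num.min (f / (sg * y) + d) 1 - Num.min (f / (sg * y)) 1)
  <= potential sg y' f'.
Proof.
move=> sg0 y0 yy' f0 d0 ff'; have y'0 : 0 < y' by exact: lt_le_trans yy'.
have r0 : 0 < y' / y by rewrite divr_gt0.
have lnr : 1 - y / y' <= ln (y' / y) by rewrite -[y / y']invf_div; exact: ln_ge_1BV.
rewrite /potential; set z := f / (sg * y).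
have z0 : 0 <= z by rewrite divr_ge0// mulr_ge0// ltW.
have -> : ln y' = ln y + ln (y' / y).
  by rewrite -lnM ?posrE// mulrCA divff ?mulr1// gt_eqF.
have z' : (z + d) * (y / y') <= f' / (sg * y').
  have -> : (z + d) * (y / y') = (f + sg * d * y) / (sg * y').
    by rewrite /z; field; rewrite !gt_eqF.
  by rewrite ler_pM2r ?invr_gt0 ?mulr_gt0.
have r1 : y / y' <= 1 by rewrite ler_pdivrMr// mul1r.
have r'0 : 0 < y / y' by rewrite divr_gt0.
suff : Num.min (z + d) 1 <= ln (y' / y) + Num.min (f' / (sg * y')) 1 by lra.
have H : Num.min (z + d) 1 * (y / y') <= Num.min (f' / (sg * y')) 1.
  rewrite le_min; apply/andP; split.
    by apply: le_trans z'; rewrite ler_pM2r// ge_min lexx.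
  rewrite -[leRHS]mulr1; apply: ler_pM => //; last by rewrite ge_min lexx orbT.
    by rewrite le_min ler01 andbT addr_ge0.
  exact: ltW.
have M1 : Num.min (z + d) 1 <= 1 by rewrite ge_min lexx orbT.
have : 0 <= (1 - y / y') * (1 - Num.min (z + d) 1) by rewrite mulr_ge0// subr_ge0.
nra.
Qed.

Lemma potential_double (R : realType) (sg y y' f f' : R) :
  0 < sg -> sg <= 1 / 2 -> 0 < y -> 4 / 3 * y <= y' -> 0 <= f -> f <= f' ->
  potential sg y f + sg / 2 <= potential sg y' f'.
Proof.
move=> sg0 sg2 y0 yy' f0 ff'.
have := @potential_gain R sg y y' f f' 0 sg0 y0 _ f0 (lexx _).
rewrite !(mulr0, mul0r, addr0, subrr) => H.
have r0 : 0 < y' / y by rewrite divr_gt0//; lra.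
have lnr := ln_ge_1BV r0; rewrite invf_div in lnr.
have : y / y' <= 3 / 4 by rewrite ler_pdivrMr; lra.
have := H _ ff'; lra.
Qed.

(** Two regimes. While the ratio f/(sg y) is at most 1 - sg, the kink adds sg y >= sg to it, as y >=
    1. Beyond that the ratio is at least 1/2, so y grows by a factor 1 + sg over the two steps and
    the logarithm gains sg/2. *)
Lemma potential_kink (R : realType) (sg y y' f e f' : R) :
  0 < sg -> sg <= 1 / 2 -> 1 <= y -> 0 <= f -> f <= e -> e + sg ^+ 2 * y ^+ 2 <= f' ->
  y + e + f' <= y' ->
  potential sg y f + sg / 2 <= potential sg y' f'.
Proof.
move=> sg0 sg2 y1 f0 fe ef' yy'.
have y0 : 0 < y by lra.
have f'0 : 0 <= f' by have : 0 <= sg ^+ 2 * y ^+ 2; [rewrite mulr_ge0 ?sqr_ge0|lra].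
have H : potential sg y f + ln (y' / y)
    + (Num.min (f / (sg * y) + sg * y) 1 - Num.min (f / (sg * y)) 1)
  <= potential sg y' f'.
  apply: potential_gain => //; first lra; first by rewrite mulr_ge0 ?ltW.
  apply: le_trans ef'; rewrite lerD//.
  by rewrite le_eqVlt; apply/orP; left; apply/eqP; ring.
set z := f / (sg * y) in H.
have z0 : 0 <= z by rewrite divr_ge0// mulr_ge0// ltW.
have fz : f = z * sg * y by rewrite /z; field; rewrite !gt_eqF.
have sgy : sg <= sg * y by rewrite ler_peMr// ltW.
have y'0 : 0 < y' by lra.
have r0 : 0 < y' / y by rewrite divr_gt0.
have lnr := ln_ge_1BV r0; rewrite invf_div in lnr.
have [zs|zs] := leP (z + sg) 1.
  have z1 : z <= 1 by lra.
  rewrite [Num.min z 1]min_l// in H.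
  have : z + sg <= Num.min (z + sg * y) 1 by rewrite le_min zs andbT lerD2l.
  have : y / y' <= 1 by rewrite ler_pdivrMr//; lra.
  lra.
have M : Num.min z 1 <= Num.min (z + sg * y) 1.
  by rewrite le_min ge_min ge_min lexx orbT andbT ler_wpDr//; lra.
have z2 : 1 / 2 <= z by lra.
have ys : y * (1 + sg) <= y'.
  have : 0 <= sg ^+ 2 * y ^+ 2 by rewrite mulr_ge0 ?sqr_ge0.
  have : 1 / 2 * (sg * y) <= z * (sg * y) by rewrite ler_wpM2r// ltW// mulr_gt0.
  nra.
suff : y / y' <= 1 - sg / 2 by lra.
rewrite ler_pdivrMr//.
have : (1 - sg / 2) * (y * (1 + sg)) <= (1 - sg / 2) * y' by rewrite ler_wpM2l//; lra.
have : 0 <= y * sg * (1/2 - sg) by rewrite !mulr_ge0//; lra.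
nra.
Qed.

(** Discrete trace of a regular survival function. The reciprocal is infinite past the support, so
    the convexity inequality is stated for positive [s k], which makes [s i] and [s j] positive
    too. *)
Definition inv_convex (R : realType) (s : nat -> R) : Prop :=
  [/\ forall k, 0 <= s k <= 1, forall i j, (i <= j)%N -> s j <= s i &
      forall i j k, (i < j < k)%N -> 0 < s k ->
        (k - i)%:R / s j <= (k - j)%:R / s i + (j - i)%:R / s k].

Lemma inv_convex_dilate (R : realType) (s : nat -> R) (w : nat) :
  (0 < w)%N -> inv_convex s -> inv_convex (fun k => s (k * w)%N).
Proof.
move=> w0 [s01 sdec sconv]; split=> [k|i j ij|i j k /andP[ij jk] sk].
- exact: s01.
- by apply: sdec; rewrite leq_mul2r ij orbT.
have := sconv (i * w)%N (j * w)%N (k * w)%N.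
rewrite !ltn_mul2r w0 ij jk => /(_ isT sk).
rewrite -!mulnBl !natrM !(mulrAC _ w%:R) -mulrDl ler_pM2r//.
by rewrite ltr0n.
Qed.

Lemma inv_convex_slopes (R : realType) (u : nat -> R) (i k : nat) :
  inv_convex u -> (i <= k)%N -> 0 < u k.+1 ->
  (u i.+1)^-1 - (u i)^-1 <= (u k.+1)^-1 - (u k)^-1.
Proof.
move=> [u01 udec uconv]; elim: k => [|k IH]; first by rewrite leqn0 => /eqP ->.
rewrite leq_eqVlt => /orP[/eqP -> //|]; rewrite ltnS => ik uk.
have uk1 : 0 < u k.+1 by apply: lt_le_trans uk _; exact: udec.
apply: le_trans (IH ik uk1) _.
have := uconv k k.+1 k.+2; rewrite !leqnn => /(_ isT uk).
rewrite !subSnn subSn ?leqW// subSnn !mul1r; lra.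
Qed.

(** For y = 1/u: y is at most 1/(7 t) at the left end, and it either grows by a factor 4/3 or has a
    second difference of at least 10 t y^2, with y taken at the left end. *)
Definition curved (R : realType) (t A M B : R) : Prop :=
  7 * t <= A /\
  (B <= 3 / 4 * A \/ 0 < B /\ 10 * t / A ^+ 2 <= A^-1 + B^-1 - 2 / M).

(* Along the curved triples of one level, y = 1/u satisfies a discrete form of
   y'' >= 10 t y^2, so it blows up after O(t^(-1/2) log(1/t)) of them; [potential]
   is a Lyapunov function for this growth, [f] a lower bound for the slope. *)
Lemma curved_path_size (R : realType) (sg t : R) (u : nat -> R) (s : seq nat)
    (j : nat) (f : R) :
  0 < t -> 0 < sg -> sg <= 1 / 2 -> sg ^+ 2 <= 10 * t -> inv_convex u ->
  path ltn j s ->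
  (forall k, k \in j :: s -> curved t (u k.*2) (u k.*2.+1) (u k.*2.+2)) ->
  0 <= f -> (0 < u j.*2.+1 -> f <= (u j.*2.+1)^-1 - (u j.*2)^-1) ->
  (size s)%:R * (sg / 2)
    <= 2 * ln (7 * t)^-1 + 1 - potential sg (u j.*2)^-1 f.
Proof.
move=> t0 sg0 sg2 sgt uc; have [u01 udec uconv] := uc.
elim: s j f => [|j' s IH] j f /=.
  move=> _ cs f0 _; rewrite mul0r subr_ge0 /potential lerD ?ge_min ?lexx ?orbT//.
  have [A7 _] := cs j (mem_head _ _).
  have A0 : 0 < u j.*2 by lra.
  rewrite ler_pM2l// ler_ln ?posrE ?invr_gt0; [|lra|lra].
  by rewrite lef_pV2// posrE; lra.
move=> /andP[jj' ps] cs f0 fe.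
have [A7 cA] := cs j (mem_head _ _).
have [A'7 _] : curved t (u j'.*2) (u j'.*2.+1) (u j'.*2.+2).
  by apply: cs; rewrite !inE eqxx orbT.
have BA' : u j'.*2 <= u j.*2.+2 by apply: udec; rewrite -doubleS leq_double.
have MB : u j.*2.+2 <= u j.*2.+1 by exact: udec.
have AM : u j.*2.+1 <= u j.*2 by exact: udec.
have /andP[_ A1] := u01 j.*2.
set A := u j.*2 in A7 cA AM A1 fe *; set M := u j.*2.+1 in cA MB AM fe *.
set B := u j.*2.+2 in cA MB BA'; set A' := u j'.*2 in A'7 BA'.
have A'0 : 0 < A' by lra.
have B0 : 0 < B by lra.
have M0 : 0 < M by lra.
have A0 : 0 < A by lra.
have {}fe := fe M0.
pose e := M^-1 - A^-1; pose f' := B^-1 - M^-1.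
have ef' : e <= f' by apply: (@inv_convex_slopes R u j.*2 j.*2.+1).
have B'A' : B^-1 <= A'^-1 by rewrite lef_pV2// posrE.
have y1 : 1 <= A^-1 by rewrite invf_ge1.
have f'0 : 0 <= f' by rewrite subr_ge0 lef_pV2// posrE.
have gain : potential sg A^-1 f + sg / 2 <= potential sg A'^-1 f'.
  have [B34|[_ kap]] := cA.
    apply: potential_double => //; [by rewrite invr_gt0| |exact: le_trans fe ef'].
    apply: le_trans B'A'; rewrite -[4 / 3]invf_div -invfM lef_pV2 ?posrE//.
    by rewrite mulr_gt0//; lra.
  apply: (@potential_kink R sg _ _ f e f') => //; last by rewrite /e /f'; lra.
  have : sg ^+ 2 * A^-1 ^+ 2 <= 10 * t / A ^+ 2.
    by rewrite exprVn ler_pM2r// invr_gt0 exprn_gt0.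
  rewrite /e /f'; lra.
have := IH j' f' ps _ f'0 _.
have Hm : forall k, k \in j' :: s -> curved t (u k.*2) (u k.*2.+1) (u k.*2.+2).
  by move=> k ks; apply: cs; rewrite inE ks orbT.
move=> /(_ Hm) H.
have {}H := H _; rewrite -natr1 mulrDl mul1r.
(* By convexity the last slope of a triple bounds from below the first slope of any later one, so
   the triples skipped in between do no harm. *)
suff : 0 < u j'.*2.+1 -> f' <= (u j'.*2.+1)^-1 - (u j'.*2)^-1 by move=> /H; lra.
move=> u0; apply: inv_convex_slopes => //.
by have : (j.+1.*2 <= j'.*2)%N; [rewrite leq_double|rewrite doubleS; exact: ltnW].
Qed.

Lemma curved_count (R : realType) (sg t : R) (u : nat -> R) (P : pred nat) (n : nat) :
  0 < t -> 0 < sg -> sg <= 1 / 2 -> sg ^+ 2 <= 10 * t -> inv_convex u ->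
  (forall k, P k -> curved t (u k.*2) (u k.*2.+1) (u k.*2.+2)) ->
  (size (seq.filter P (iota 0 n)))%:R <= 1 + 2 / sg * (2 * `|ln (7 * t)^-1| + 1).
Proof.
move=> t0 sg0 sg2 sgt uc cP.
have : path.sorted ltn (seq.filter P (iota 0 n)).
  by apply: sorted_filter; [exact: ltn_trans|exact: iota_ltn_sorted].
have: forall k, k \in seq.filter P (iota 0 n) -> curved t (u k.*2) (u k.*2.+1) (u k.*2.+2).
  by move=> k; rewrite mem_filter => /andP[/cP].
have T0 : 0 <= 2 / sg * (2 * `|ln (7 * t)^-1| + 1).
  by rewrite mulr_ge0 ?addr_ge0// ?mulr_ge0// ltW ?invr_gt0.
case: (seq.filter _ _) => [_ _|j s cs ss] /=; first by lra.
have [u01 udec uconv] := uc.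
have := @curved_path_size R sg t u s j 0 t0 sg0 sg2 sgt uc ss cs (lexx _).
move=> H; rewrite -natr1 addrC lerD2l -[leRHS]mulrC -ler_pdivrMr ?divr_gt0//.
rewrite invf_div.
have {}H := H _.
have [A7 _] := cs j (mem_head _ _).
have A0 : 0 < u j.*2 by lra.
have /andP[_ A1] := u01 j.*2.
have P0 : 0 <= potential sg (u j.*2)^-1 0.
  rewrite /potential mul0r min_l// addr0 mulr_ge0// ln_ge0//.
  by rewrite invf_ge1.
have H' : 0 < u j.*2.+1 -> 0 <= (u j.*2.+1)^-1 - (u j.*2)^-1.
  by move=> u0; rewrite subr_ge0 lef_pV2 ?posrE// udec.
have := H H'; have := ler_norm (ln (7 * t)^-1); lra.
Qed.

(* The test on noisy values al, mu, be of s at the ends and the middle of an interval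
   that decides whether the bisection goes on: s is not negligible there, and either it
   drops by a factor 2 or its middle value exceeds the harmonic mean of the end values. *)
Definition refine (R : realType) (t al mu be : R) : bool :=
  (8 * t < al) && ((be < al / 2) || (2 / (al^-1 + be^-1) + 8 * t < mu)).

(** The partial derivatives of the harmonic mean 2ab/(a+b) are 2b^2/(a+b)^2 and 2a^2/(a+b)^2, whose
    sum is at most 2. *)
Lemma harmonic_lipschitz (R : realType) (a b a' b' t : R) :
  0 < a -> 0 < b -> 0 < a' -> 0 < b' -> 0 <= t -> a' <= a + t -> b' <= b + t ->
  2 / (a'^-1 + b'^-1) <= 2 / (a^-1 + b^-1) + 2 * t.
Proof.
move=> a0 b0 a'0 b'0 t0 aa bb.
apply: (@le_trans _ _ (2 / ((a + t)^-1 + (b + t)^-1))).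
  rewrite ler_pM2l// lef_pV2 ?posrE ?addr_gt0 ?invr_gt0//; try lra.
  by rewrite lerD// lef_pV2 ?posrE//; lra.
have -> : 2 / ((a + t)^-1 + (b + t)^-1) = 2 * (a + t) * (b + t) / (a + b + 2 * t).
  by field; do ?split; rewrite gt_eqF//; lra.
have -> : 2 / (a^-1 + b^-1) + 2 * t = (2 * a * b + 2 * t * (a + b)) / (a + b).
  by field; do ?split; rewrite gt_eqF//; lra.
rewrite ler_pdivrMr; last lra.
rewrite [leRHS]mulrAC ler_pdivlMr; last lra.
have : 0 <= t * a * b by rewrite !mulr_ge0// ltW.
have : 0 <= t * t * (a + b) by rewrite !mulr_ge0//; lra.
nra.
Qed.

Lemma harmonic_le (R : realType) (a b : R) : 0 < b -> b <= a ->
  b <= 2 / (a^-1 + b^-1) <= a.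
Proof.
move=> b0 ba; have a0 : 0 < a by exact: lt_le_trans ba.
have V : a^-1 <= b^-1 by rewrite lef_pV2.
have Va : 0 < a^-1 by rewrite invr_gt0.
have aV : a * a^-1 = 1 by rewrite divff ?gt_eqF.
have bV : b * b^-1 = 1 by rewrite divff ?gt_eqF.
have W : 0 < a^-1 + b^-1 by lra.
by apply/andP; split; [rewrite ler_pdivlMr//|rewrite ler_pdivrMr//]; nra.
Qed.

(** Of the margin 8 t, the noise of the middle value uses up t and that of the harmonic mean H uses
    up 2 t. This leaves M - H >= 5 t, that is a second difference 2 (M - H)/(M H) >= 10 t/A^2. The
    factor 1/2 degrades to 3/4 because 3 t/2 <= A/4 when A >= 7 t. *)
Lemma refine_curved (R : realType) (t A M B al mu be : R) :
  0 < t -> `|A - al| <= t -> `|M - mu| <= t -> `|B - be| <= t ->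
  0 <= B -> B <= M -> M <= A -> refine t al mu be -> curved t A M B.
Proof.
rewrite !ler_norml => t0 /andP[A1 A2] /andP[M1 M2] /andP[B1 B2] B0 BM MA.
move=> /andP[al8 r]; split; first lra.
have [bal|bal] := ltP be (al / 2); first by left; lra.
rewrite ltNge bal /= in r; have {}B0 : 0 < B by lra.
right; split => //; have A0 : 0 < A by lra.
have M0 : 0 < M by lra.
have al0 : 0 < al by lra.
have be0 : 0 < be by lra.
have L : 2 / (A^-1 + B^-1) <= 2 / (al^-1 + be^-1) + 2 * t.
  by apply: harmonic_lipschitz; lra.
have BA : B <= A by lra.
have /andP[H1 H2] := harmonic_le B0 BA.
set H := 2 / (A^-1 + B^-1) in L H1 H2.
have -> : A^-1 + B^-1 - 2 / M = 2 * (M - H) / (M * H).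
  by rewrite /H; field; rewrite !gt_eqF//; lra.
have H0 : 0 < H by lra.
have MH0 : 0 < M * H by exact: mulr_gt0.
rewrite ler_pdivrMr ?exprn_gt0// [leRHS]mulrAC ler_pdivlMr//.
have MH : M * H <= A ^+ 2 by rewrite expr2 ler_pM//; lra.
have D : 5 * t <= M - H by lra.
have : 0 <= (M - H - 5 * t) * A ^+ 2 by rewrite mulr_ge0 ?sqr_ge0//; lra.
have : 0 <= t * (A ^+ 2 - M * H) by rewrite mulr_ge0//; lra.
nra.
Qed.

(** Here c is the relative position of a point in the interval. 1/X lies below the chord from 1/A to
    1/B, and 1/X' lies above the chord from 1/A' to 1/B' up to K, since a failed test keeps M' close
    to the harmonic mean. The two chords differ by at most J. Multiplying by X X' <= A A', with end
    values of ratio at most 3, turns J + K into 9 (2 + 22) t = 216 t. *)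
Lemma flat_le (R : realType) (t al mu be A B A' M' B' X X' c : R) :
  0 < t -> ~~ refine t al mu be -> 8 * t < al ->
  `|A - al| <= t -> `|B - be| <= t ->
  `|A' - al| <= t -> `|M' - mu| <= t -> `|B' - be| <= t ->
  B <= A -> B' <= M' -> M' <= A' -> 0 < X <= A -> 0 < X' <= A' -> 0 <= c <= 1 ->
  X^-1 <= (1 - c) / A + c / B ->
  (2 - 2 * c) / M' - (1 - 2 * c) / B' <= X'^-1 \/
  2 * c / M' - (2 * c - 1) / A' <= X'^-1 ->
  X' <= X + 216 * t.
Proof.
rewrite !ler_norml /refine => t0 nr al8 /andP[A1 A2] /andP[B1 B2].
move=> /andP[A'1 A'2] /andP[M'1 M'2] /andP[B'1 B'2] BA BM MA.
move=> /andP[X0 XA] /andP[X'0 X'A] /andP[c0 c1] Xle X'ge.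
move: nr; rewrite al8 /= negb_or -!leNgt => /andP[bal r].
have al0 : 0 < al by lra.
have be0 : 0 < be by lra.
have B'0 : 0 < B' by lra.
have B0 : 0 < B by lra.
have A'0 : 0 < A' by lra.
have A0 : 0 < A by lra.
have M'0 : 0 < M' by lra.
have L : 2 / (al^-1 + be^-1) <= 2 / (A'^-1 + B'^-1) + 2 * t.
  by apply: harmonic_lipschitz; lra.
have BA' : B' <= A' by lra.
have /andP[H1 H2] := harmonic_le B'0 BA'.
have EH : 2 / (2 / (A'^-1 + B'^-1)) = A'^-1 + B'^-1.
  by field; do ?split; rewrite gt_eqF//; lra.
set H := 2 / (A'^-1 + B'^-1) in L H1 H2 EH.
have H0 : 0 < H by lra.
(* From al/2 <= be and al > 8 t: A <= al + t <= 3 (al/2 - t) <= 3 B, and likewise for the others. *)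
have [rAB rAB' rA'B'] : [/\ A <= 3 * B, A <= 3 * B' & A' <= 3 * B'] by split; lra.
have dA : A' - A <= 2 * t by lra.
have dB : B' - B <= 2 * t by lra.
(* 8 t from the failed test, 2 t from the harmonic mean, t from the middle value. *)
have D : M' - H <= 11 * t by lra.
have [t0' A0' B0' A'0' B'0'] : [/\ 0 <= t, 0 <= A, 0 <= B, 0 <= A' & 0 <= B'].
  by split; exact: ltW.
clear L r bal al8 A1 A2 B1 B2 A'1 A'2 M'1 M'2 B'1 B'2 al0 be0.
have M'H : A'^-1 + B'^-1 - 22 * t / B' ^+ 2 <= 2 / M'.
  rewrite -EH.
  have E : 2 / H - 2 / M' = 2 * (M' - H) / (M' * H).
    by field; rewrite !gt_eqF//.
  suff : 2 * (M' - H) / (M' * H) <= 22 * t / B' ^+ 2 by lra.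
  have MH0 : 0 < M' * H by exact: mulr_gt0.
  rewrite ler_pdivrMr// [leRHS]mulrAC ler_pdivlMr ?exprn_gt0//.
  have MH : B' ^+ 2 <= M' * H by rewrite expr2 ler_pM.
  have : 0 <= (11 * t - (M' - H)) * B' ^+ 2 by rewrite mulr_ge0 ?sqr_ge0// subr_ge0.
  have : 0 <= t * (M' * H - B' ^+ 2) by rewrite mulr_ge0// subr_ge0.
  clear; lra.
set K := 22 * t / B' ^+ 2 in M'H.
have K0 : 0 <= K by rewrite divr_ge0 ?sqr_ge0// mulr_ge0.
have X'K : (1 - c) / A' + c / B' - K <= X'^-1.
  case: X'ge => X'ge; apply: le_trans X'ge.
    have -> : (2 - 2 * c) / M' = (1 - c) * (2 / M') by ring.
    have : (1 - c) * (A'^-1 + B'^-1 - K) <= (1 - c) * (2 / M').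
      by rewrite ler_wpM2l// subr_ge0.
    have : 0 <= c * K by rewrite mulr_ge0.
    clear; lra.
  have -> : 2 * c / M' = c * (2 / M') by ring.
  have : c * (A'^-1 + B'^-1 - K) <= c * (2 / M') by rewrite ler_wpM2l// subr_ge0.
  have : 0 <= (1 - c) * K by rewrite mulr_ge0// subr_ge0.
  clear; lra.
have EA : A^-1 - A'^-1 <= 2 * t / (B * B').
  have -> : A^-1 - A'^-1 = (A' - A) / (A * A') by field; rewrite !gt_eqF.
  apply: (@le_trans _ _ (2 * t / (A * A'))).
    by rewrite ler_pM2r ?invr_gt0 ?mulr_gt0.
  rewrite ler_pM2l ?mulr_gt0//.
  by rewrite lef_pV2 ?posrE ?mulr_gt0// ler_pM.
have EB : B^-1 - B'^-1 <= 2 * t / (B * B').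
  have -> : B^-1 - B'^-1 = (B' - B) / (B * B') by field; rewrite !gt_eqF.
  by rewrite ler_pM2r ?invr_gt0 ?mulr_gt0.
set J := 2 * t / (B * B') in EA EB.
have XX' : X^-1 - X'^-1 <= J + K.
  have : (1 - c) * (A^-1 - A'^-1) <= (1 - c) * J by rewrite ler_wpM2l// subr_ge0.
  have : c * (B^-1 - B'^-1) <= c * J by rewrite ler_wpM2l// subr_ge0.
  move: Xle X'K; clear; lra.
have J0 : 0 <= J by rewrite divr_ge0 ?mulr_ge0.
have P : X' - X <= A * A' * (J + K).
  have -> : X' - X = X * X' * (X^-1 - X'^-1) by field; rewrite !gt_eqF.
  apply: (@le_trans _ _ (X * X' * (J + K))); first by rewrite ler_pM2l ?mulr_gt0.
  by rewrite ler_wpM2r ?addr_ge0// ler_pM// ltW.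
have PJ : A * A' * J <= 18 * t.
  rewrite /J mulrA ler_pdivrMr ?mulr_gt0//.
  have Q : A * A' <= (3 * B) * (3 * B') by exact: ler_pM.
  have : 0 <= t * ((3 * B) * (3 * B') - A * A') by rewrite mulr_ge0// subr_ge0.
  clear; lra.
have PK : A * A' * K <= 198 * t.
  rewrite /K mulrA ler_pdivrMr ?exprn_gt0//.
  have Q : A * A' <= (3 * B') * (3 * B') by exact: ler_pM.
  have : 0 <= t * ((3 * B') * (3 * B') - A * A') by rewrite mulr_ge0// subr_ge0.
  clear; lra.
move: P PJ PK; clear; lra.
Qed.

(** The lower bound for 1/s' at x comes from extending the chord of 1/s' over the half that does not
    contain x; this is where the middle value enters. If [al] is at most 8 t, monotonicity alone
    gives s' x <= al + t <= 9 t. *)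
Lemma flat_interval (R : realType) (t al mu be : R) (s s' : nat -> R) (a r x : nat) :
  0 < t -> inv_convex s -> inv_convex s' -> (0 < r)%N ->
  ~~ refine t al mu be ->
  `|s a - al| <= t -> `|s (a + r.*2)%N - be| <= t ->
  `|s' a - al| <= t -> `|s' (a + r)%N - mu| <= t -> `|s' (a + r.*2)%N - be| <= t ->
  (a <= x <= a + r.*2)%N -> s' x <= s x + 216 * t.
Proof.
move=> t0 [s01 sdec sconv] [s'01 s'dec s'conv] r0 nr Al Be Al' Mu' Be' /andP[ax xb].
have [al8|al8] := leP al (8 * t).
  have := s'dec _ _ ax; have /andP[+ _] := s01 x.
  move: Al'; rewrite ler_norml => /andP[_]; lra.
have [bal] : al / 2 <= be.
  by move: nr; rewrite /refine al8 /= negb_or -leNgt => /andP[].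
have B0 : 0 < s (a + r.*2)%N by move: Be; rewrite ler_norml => /andP[]; lra.
have B'0 : 0 < s' (a + r.*2)%N by move: Be'; rewrite ler_norml => /andP[]; lra.
have X0 : 0 < s x by exact: lt_le_trans B0 (sdec _ _ xb).
have X'0 : 0 < s' x by exact: lt_le_trans B'0 (s'dec _ _ xb).
pose c : R := (x - a)%:R / (r.*2)%:R.
have rR : 0 < (r.*2)%:R :> R by rewrite ltr0n double_gt0.
have rR1 : 0 < r%:R :> R by rewrite ltr0n.
have r2 : (r.*2)%:R = 2 * r%:R :> R by rewrite -mul2n natrM.
have xE : (x - a)%:R = x%:R - a%:R :> R by rewrite natrB.
have cE : c * (2 * r%:R) = x%:R - a%:R by rewrite /c xE -r2 mulfVK// gt_eqF.
have c01 : 0 <= c <= 1.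
  by rewrite /c divr_ge0//= ler_pdivrMr// mul1r ler_nat leq_subLR.
apply: (flat_le t0 nr al8 Al Be Al' Mu' Be' _ _ _ _ _ c01).
- by apply: sdec; rewrite leq_addr.
- by apply: s'dec; rewrite leq_add2l -addnn leq_addr.
- by apply: s'dec; rewrite leq_addr.
- by rewrite X0 sdec.
- by rewrite X'0 s'dec.
- move: ax xb; rewrite leq_eqVlt => /orP[/eqP ax' _|ax].
    by rewrite /c -ax' subnn mul0r subr0 mul0r addr0 mul1r.
  rewrite leq_eqVlt => /orP[/eqP xb'|xb].
    by rewrite /c xb' addKn divff ?gt_eqF// subrr mul0r add0r mul1r.
  have := sconv a x (a + r.*2)%N; rewrite ax xb => /(_ isT B0).
  rewrite addKn natrB; last exact: ltnW.
  rewrite xE natrD r2 -cE => H.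
  rewrite -(ler_pM2l (_ : 0 < 2 * r%:R)) ?mulr_gt0//.
  apply: le_trans H _; rewrite le_eqVlt; apply/orP; left; apply/eqP.
  rewrite (_ : a%:R + 2 * r%:R - x%:R = (1 - c) * (2 * r%:R)); first by ring.
  by rewrite mulrBl cE; ring.
- have [xm|mx|xm] := ltngtP x (a + r)%N.
  + left; have := s'conv x (a + r)%N (a + r.*2)%N.
    rewrite xm ltn_add2l -addnn -[X in (X < _)%N]addn0 ltn_add2l r0 => /(_ isT).
    rewrite addnn => /(_ B'0); rewrite !natrB ?leq_add2l -?addnn ?leq_addr//; [|exact: ltnW|by rewrite addnn].
    rewrite addnn.
    rewrite !natrD r2 => H; rewrite -(ler_pM2r rR1).
    have E : a%:R + r%:R - x%:R = (1 - 2 * c) * r%:R :> R.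
      by move: cE; clear; lra.
    have E2 : a%:R + 2 * r%:R - x%:R = (2 - 2 * c) * r%:R :> R.
      by move: cE; clear; lra.
    move: H; rewrite E E2 (_ : a%:R + 2 * r%:R - (a%:R + r%:R) = r%:R); last ring.
    by clear; lra.
  + right; have := s'conv a (a + r)%N x; rewrite mx -[X in (X < a + r)%N]addn0 ltn_add2l r0.
    move=> /(_ isT X'0); rewrite !natrB ?leq_addr//; [|exact: ltnW].
    rewrite !natrD => H; rewrite -(ler_pM2r rR1).
    have E : x%:R - (a%:R + r%:R) = (2 * c - 1) * r%:R :> R.
      by move: cE; clear; lra.
    have E2 : x%:R - a%:R = 2 * c * r%:R :> R by move: cE; clear; lra.
    move: H; rewrite E E2 (_ : a%:R + r%:R - a%:R = r%:R); last ring.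
    by clear; lra.
  + left; have -> : c = 2^-1.
      by rewrite /c xm addKn r2; field; rewrite gt_eqF.
    rewrite xm.
    by rewrite divff// subrr mul0r subr0 (_ : 2 - 1 = 1 :> R) ?mul1r//; ring.
Qed.

(* A transcript is a list of grid points with the estimates obtained there.  The
   dyadic triple (i, j) is [j.*2 * 2^i, j.*2.+1 * 2^i, j.*2.+2 * 2^i]; its two halves
   are the triples (i-1, j.*2) and (i-1, j.*2.+1). *)
Definition refined (R : realType) (t : R) (tr : seq (nat * R)) (i j : nat) : Prop :=
  exists al mu be, [/\ ((j.*2 * 2 ^ i)%N, al) \in tr, ((j.*2.+1 * 2 ^ i)%N, mu) \in tr,
    ((j.*2.+2 * 2 ^ i)%N, be) \in tr & refine t al mu be].

(** The initial points form the triple (L-1, 0); the others are the midpoints of the two halves of a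
    triple satisfying [P]. Keeping [P] abstract lets one notion serve both the strategy, with
    [refined], and the counting, with [curved]. *)
Definition reach (P : nat -> nat -> Prop) (L v : nat) : Prop :=
  v \in [:: 0; 2 ^ L; 2 ^ L.-1]%N \/
  exists i j, [/\ (i.+1 < L)%N, (j < 2 ^ L)%N, P i.+1 j &
    v \in [:: j.*2.*2.+1 * 2 ^ i; j.*2.+1.*2.+1 * 2 ^ i]%N].

Definition pending (R : realType) (L : nat) (t : R) (tr : seq (nat * R)) (v : nat) : Prop :=
  v \notin unzip1 tr /\ reach (refined t tr) L v.

(** Any pending point will do. If there is none, the default 0 is queried again; the analysis only
    looks at a prefix of the transcript that leaves nothing pending. *)
Definition next_point (R : realType) (L : nat) (t : R) (tr : seq (nat * R)) : nat :=
  xget 0%N [set v | pending L t tr v].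

Definition accurate (R : realType) (t : R) (s : nat -> R) (tr : seq (nat * R)) : Prop :=
  forall v a, (v, a) \in tr -> `|s v - a| <= t.

Lemma mem_unzip1 (T1 T2 : eqType) (tr : seq (T1 * T2)) v :
  v \in unzip1 tr -> exists a, (v, a) \in tr.
Proof. by move=> /mapP[[w a] wtr /= ->]; exists a. Qed.

Lemma saturated_close (R : realType) (L : nat) (t : R) (tr : seq (nat * R))
    (s s' : nat -> R) :
  (0 < L)%N -> 0 < t -> inv_convex s -> inv_convex s' ->
  accurate t s tr -> accurate t s' tr -> (forall v, ~ pending L t tr v) ->
  forall x, (x <= 2 ^ L)%N -> s' x <= s x + 216 * t.
Proof.
move=> L0 t0 sc s'c acc acc' sat.
have query v : v \in unzip1 tr -> s' v <= s v + 216 * t.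
  move=> /mem_unzip1[a vtr]; have := acc _ _ vtr; have := acc' _ _ vtr.
  rewrite !ler_norml => /andP[_ ?] /andP[? _]; lra.
have reached v : reach (refined t tr) L v -> v \in unzip1 tr.
  by move=> rv; apply/negPn/negP => nv; apply: (sat v); split.
(* The midpoints of the halves of a refined triple have been queried, so the hypotheses pass to both
   halves. The recursion ends at a triple that fails the test or at three consecutive grid
   points. *)
have claim i : forall j, (i < L)%N -> (j.*2.+2 * 2 ^ i <= 2 ^ L)%N ->
    (j.*2 * 2 ^ i)%N \in unzip1 tr -> (j.*2.+1 * 2 ^ i)%N \in unzip1 tr ->
    (j.*2.+2 * 2 ^ i)%N \in unzip1 tr ->
    forall x, (j.*2 * 2 ^ i <= x <= j.*2.+2 * 2 ^ i)%N -> s' x <= s x + 216 * t.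
  elim: i => [|i IH] j iL jL qa qm qb x /andP[ax xb].
    rewrite !muln1 in ax xb qa qm qb; move: ax; rewrite leq_eqVlt => /orP[/eqP<-|ax].
      exact: query.
    move: ax; rewrite leq_eqVlt => /orP[/eqP<-|ax]; first exact: query.
    by rewrite (_ : x = j.*2.+2); [exact: query|apply/eqP; rewrite eqn_leq xb].
  have [rij|nrij] := pselect (refined t tr i.+1 j); last first.
    have [al qa'] := mem_unzip1 qa; have [mu qm'] := mem_unzip1 qm.
    have [be qb'] := mem_unzip1 qb.
    have nr : ~~ refine t al mu be.
      by apply/negP => r; apply: nrij; exists al, mu, be.
    have Em : (j.*2.+1 * 2 ^ i.+1 = j.*2 * 2 ^ i.+1 + 2 ^ i.+1)%N by rewrite mulSn addnC.
    have Eb : (j.*2.+2 * 2 ^ i.+1 = j.*2 * 2 ^ i.+1 + (2 ^ i.+1).*2)%N.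
      by rewrite 2!mulSn addnA addnC addnn.
    apply: (@flat_interval R t al mu be s s' (j.*2 * 2 ^ i.+1) (2 ^ i.+1) x) => //.
    - by rewrite expn_gt0.
    - exact: acc.
    - by rewrite -Eb; apply: acc.
    - exact: acc'.
    - by rewrite -Em; apply: acc'.
    - by rewrite -Eb; apply: acc'.
    - by rewrite -Eb ax.
  have jL' : (j < 2 ^ L)%N.
    apply: leq_trans jL; apply: leq_trans (leq_pmulr _ _); last by rewrite expn_gt0.
    by rewrite -doubleS -addnn leq_addr.
  have E k : (k * 2 ^ i.+1 = k.*2 * 2 ^ i)%N by rewrite expnS mulnA muln2.
  rewrite !E in ax xb qa qm qb jL.
  have q1 : (j.*2.*2.+1 * 2 ^ i)%N \in unzip1 tr.
    by apply: reached; right; exists i, j; split=> //; rewrite !inE eqxx.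
  have q2 : (j.*2.+1.*2.+1 * 2 ^ i)%N \in unzip1 tr.
    by apply: reached; right; exists i, j; split=> //; rewrite !inE eqxx orbT.
  have [xm|mx] := leqP x (j.*2.+1.*2 * 2 ^ i).
    apply: (IH j.*2) => //; [exact: ltnW| |by rewrite ax].
    by apply: leq_trans jL; rewrite leq_mul2r -doubleS leq_double leqnSn orbT.
  by apply: (IH j.*2.+1) => //; [exact: ltnW|rewrite ltnW].
have EL : (2 * 2 ^ L.-1 = 2 ^ L)%N by rewrite -expnS prednK.
move=> x xL; apply: (claim L.-1 0%N); rewrite ?double0 ?mul0n ?mul1n ?EL//.
- by rewrite prednK.
- by apply: reached; left; rewrite !inE eqxx.
- by apply: reached; left; rewrite !inE eqxx !orbT.
- by apply: reached; left; rewrite !inE eqxx orbT.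
Qed.

Lemma size_flatten_le (R : realType) (T U : eqType) (f : T -> seq U) (l : seq T) (B : R) :
  (forall x, x \in l -> (size (f x))%:R <= B) ->
  (size (flatten [seq f x | x <- l]))%:R <= (size l)%:R * B.
Proof.
elim: l => [|x l IH] fB /=; first by rewrite mul0r.
rewrite size_cat natrD -natr1 mulrDl mul1r addrC lerD//; last by apply: fB; exact: mem_head.
by apply: IH => y yl; apply: fB; rewrite inE yl orbT.
Qed.

Lemma reach_size (R : realType) (L : nat) (P : nat -> pred nat) (l : seq nat) (Q : R) :
  uniq l -> (forall v, v \in l -> reach (fun i j => P i j) L v) ->
  (forall i, (size (seq.filter (P i) (iota 0 (2 ^ L))))%:R <= Q) ->
  (size l)%:R <= 3 + L%:R * (Q * 2).
Proof.
move=> ul lr PQ.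
pose kids i := flatten [seq [:: j.*2.*2.+1 * 2 ^ i; j.*2.+1.*2.+1 * 2 ^ i]%N
  | j <- seq.filter (P i.+1) (iota 0 (2 ^ L))].
pose cover := [:: 0; 2 ^ L; 2 ^ L.-1]%N ++ flatten [seq kids i | i <- iota 0 L].
have lc : {subset l <= cover}.
  move=> v /lr[v3|[i [j [iL jL Pij vk]]]]; rewrite mem_cat ?v3//.
  apply/orP; right; apply/flatten_mapP; exists i; first by rewrite mem_iota /= add0n (ltnW iL).
  by apply/flatten_mapP; exists j => //; rewrite mem_filter Pij mem_iota.
apply: (@le_trans _ _ (size cover)%:R); first by rewrite ler_nat uniq_leq_size.
rewrite size_cat natrD lerD2l.
apply: le_trans (size_flatten_le (B := Q * 2) _) _; last by rewrite size_iota.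
move=> i _; apply: le_trans (size_flatten_le (B := 2) _) _; first by [].
by rewrite ler_pM2r.
Qed.

(** * Transcripts and termination of the bisection *)

Definition transcript (R : realType) (strat : seq (nat * R) -> nat) (ans : nat -> R) :=
  fix tr k := if k is k'.+1 then rcons (tr k') (strat (tr k'), ans k') else [::].

Lemma transcript_sub (R : realType) (strat : seq (nat * R) -> nat) (ans : nat -> R) k K :
  (k <= K)%N -> {subset transcript strat ans k <= transcript strat ans K}.
Proof.
elim: K => [|K IH]; first by rewrite leqn0 => /eqP ->.
rewrite leq_eqVlt => /orP[/eqP -> //|]; rewrite ltnS => /IH kK v /kK vK /=.
by rewrite mem_rcons inE vK orbT.
Qed.

Lemma size_transcript (R : realType) (strat : seq (nat * R) -> nat) (ans : nat -> R) k :
  size (transcript strat ans k) = k.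
Proof. by elim: k => //= k IH; rewrite size_rcons IH. Qed.

(** As long as something is pending, each round queries a new point. Apart from the three initial
    points it is the midpoint of a half of a triple passing the test, which is [curved] for the true
    [s]. [curved_count] bounds these triples at each of the L levels, so K distinct points would be
    too many. *)
Lemma bisection_saturates (R : realType) (sg t : R) (L K : nat) (s ans : nat -> R) :
  0 < t -> 0 < sg -> sg <= 1 / 2 -> sg ^+ 2 <= 10 * t -> inv_convex s ->
  accurate t s (transcript (next_point L t) ans K) ->
  3 + L%:R * ((1 + 2 / sg * (2 * `|ln (7 * t)^-1| + 1)) * 2) < K%:R ->
  exists2 k, (k <= K)%N & forall v, ~ pending L t (transcript (next_point L t) ans k) v.
Proof.
move=> t0 sg0 sg2 sgt sc acc KQ; set T := transcript _ ans in acc *.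
have [s01 sdec _] := sc.
apply: contrapT => nsat.
have unsat k : (k <= K)%N -> pending L t (T k) (next_point L t (T k)).
  move=> kK; have [v pv] : exists v, pending L t (T k) v.
    apply: contrapT => np; apply: nsat; exists k => // v pv.
    by apply: np; exists v.
  exact: (@xgetPex _ 0%N [set v | pending L t (T k) v] (ex_intro _ v pv)).
pose P i j := `[< curved t (s (j.*2 * 2 ^ i)%N) (s (j.*2.+1 * 2 ^ i)%N)
  (s (j.*2.+2 * 2 ^ i)%N) >].
have inv k : (k <= K)%N -> uniq (unzip1 (T k)) /\
    forall v, v \in unzip1 (T k) -> reach (fun i j => P i j) L v.
  elim: k => [//|k IH] kK; have [uk rk] := IH (ltnW kK).
  have [nv rv] := unsat k (ltnW kK).
  have -> : unzip1 (T k.+1) = rcons (unzip1 (T k)) (next_point L t (T k)).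
    by rewrite /= /unzip1 map_rcons.
  split; first by rewrite rcons_uniq nv.
  move=> v; rewrite mem_rcons inE => /orP[/eqP ->|/rk//].
  case: rv => [v3|[i [j [iL jL [al [mu [be [qa qm qb r]]]] vk]]]]; first by left.
  right; exists i, j; split => //; apply/asboolP.
  have kT := @transcript_sub R (next_point L t) ans _ _ (ltnW kK).
  apply: (refine_curved t0 _ _ _ _ _ _ r); try by apply: acc; apply: kT.
  - by have /andP[] := s01 (j.*2.+2 * 2 ^ i.+1)%N.
  - by apply: sdec; rewrite leq_mul2r leqnSn orbT.
  - by apply: sdec; rewrite leq_mul2r leqnSn orbT.
have [uK rK] := inv K (leqnn K).
have := @reach_size R L P _ (1 + 2 / sg * (2 * `|ln (7 * t)^-1| + 1)) uK rK.
rewrite size_map size_transcript.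
rewrite leNgt KQ /= => H; suff : false by []; apply: H => i.
apply: (curved_count (u := fun k => s (k * 2 ^ i)%N)) => //.
  by apply: inv_convex_dilate; rewrite ?expn_gt0.
by move=> k /asboolP.
Qed.

Lemma bisection_close (R : realType) (sg t : R) (L K : nat) (s s' ans : nat -> R) :
  (0 < L)%N -> 0 < t -> 0 < sg -> sg <= 1 / 2 -> sg ^+ 2 <= 10 * t ->
  3 + L%:R * ((1 + 2 / sg * (2 * `|ln (7 * t)^-1| + 1)) * 2) < K%:R ->
  inv_convex s -> inv_convex s' ->
  accurate t s (transcript (next_point L t) ans K) ->
  accurate t s' (transcript (next_point L t) ans K) ->
  forall x, (x <= 2 ^ L)%N -> s' x <= s x + 216 * t.
Proof.
move=> L0 t0 sg0 sg2 sgt KQ sc s'c acc acc'.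
have [k kK sat] := bisection_saturates t0 sg0 sg2 sgt sc acc KQ.
have kT := @transcript_sub R (next_point L t) ans _ _ kK.
apply: (saturated_close L0 t0 sc s'c _ _ sat).
  by move=> v a /kT; exact: acc.
by move=> v a /kT; exact: acc'.
Qed.

(** * Regular distributions *)

Lemma obs_prob_ge0 (R : realType) (mu : probability R R) b p : 0 <= obs_prob mu b p.
Proof. by rewrite /obs_prob; case: b; exact: fine_ge0. Qed.

Lemma EFin_fine_prob (R : realType) (mu : probability R R) (A : set R) :
  measurable A -> (fine (mu A))%:E = mu A.
Proof. by move=> mA; rewrite fineK// fin_num_measure. Qed.

Lemma fine_prob_le (R : realType) (mu : probability R R) (A B : set R) :
  measurable A -> measurable B -> A `<=` B -> fine (mu A) <= fine (mu B).
Proof.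
by move=> mA mB AB; rewrite -lee_fin !EFin_fine_prob//; apply: le_measure; rewrite ?inE.
Qed.

Lemma obs_prob_sum (R : realType) (mu : probability R R) p :
  obs_prob mu true p + obs_prob mu false p = 1.
Proof.
apply: EFin_inj; rewrite EFinD /obs_prob !EFin_fine_prob//.
rewrite -measureU//; last first.
  by apply/seteqP; split => x //=; rewrite !in_itv/= andbT => -[]; case: ltP.
rewrite (_ : _ `|` _ = setT); first exact: probability_setT.
by apply/seteqP; split => x //= _; rewrite !in_itv/= andbT; case: leP; [left|right].
Qed.

Lemma cdf_of_le (R : realType) (mu : probability R R) x y :
  x <= y -> cdf_of mu x <= cdf_of mu y.
Proof.
move=> xy; apply: fine_prob_le => // z /=; rewrite !in_itv/= => /le_trans; exact.
Qed.

Lemma cdf_of_le1 (R : realType) (mu : probability R R) x : cdf_of mu x <= 1.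
Proof. by rewrite -lee_fin /cdf_of EFin_fine_prob// probability_le1. Qed.

Lemma cdf_of_ge0 (R : realType) (mu : probability R R) x : 0 <= cdf_of mu x.
Proof. exact: fine_ge0. Qed.

Lemma cdf_le_obs_false (R : realType) (mu : probability R R) x p :
  x < p -> cdf_of mu x <= obs_prob mu false p.
Proof.
by move=> xy; apply: fine_prob_le => // z /=; rewrite !in_itv/= => /le_lt_trans; exact.
Qed.

Lemma obs_false_le_cdf (R : realType) (mu : probability R R) p :
  obs_prob mu false p <= cdf_of mu p.
Proof. by apply: fine_prob_le => // z /=; rewrite !in_itv/= => /ltW. Qed.

Lemma obs_false_le (R : realType) (mu : probability R R) p c :
  (forall x, x < p -> cdf_of mu x <= c) -> obs_prob mu false p <= c.
Proof.
move=> Fc; rewrite -lee_fin /obs_prob EFin_fine_prob//.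
pose A (n : nat) : set R := [set` `]-oo, p - n.+1%:R^-1]].
have pA n : p - n.+1%:R^-1 < p by rewrite ltrBlDr ltrDl invr_gt0.
have AE : [set` `]-oo, p[] = \bigcup_n A n.
  apply/seteqP; split => [x /=|x [n _]]; rewrite /A /= !in_itv/=; last first.
    by move=> xp; exact: le_lt_trans xp (pA n).
  move=> xp; have d0 : 0 < p - x by rewrite subr_gt0.
  exists (Num.truncn (p - x)^-1) => //=; rewrite /A /= in_itv/= lerBrDr -lerBrDl.
  rewrite -[leRHS]invrK lef_pV2 ?posrE ?invr_gt0//.
  exact/ltW/truncnS_gt.
have ndA : nondecreasing_seq A.
  move=> n k nk; apply/subsetPset => x /=; rewrite /A /= !in_itv/= => xp.
  apply: le_trans xp _.
  by rewrite lerD2l lerN2 lef_pV2 ?posrE// ler_nat ltnS.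
have mA n : measurable (A n) by exact: measurable_itv.
have cv : mu \o A @ \oo --> mu (\bigcup_n A n).
  by apply: nondecreasing_cvg_mu => //; exact: bigcup_measurable.
rewrite AE -(cvg_lim _ cv)//; apply: lime_le; first by apply/cvg_ex; eexists; exact: cv.
by apply: nearW => n /=; rewrite -EFin_fine_prob// lee_fin; apply: Fc.
Qed.

Lemma supported_cdf (R : realType) (mu : probability R R) : supported01 mu ->
  (forall x, x < 0 -> cdf_of mu x = 0) /\ (forall x, 1 <= x -> cdf_of mu x = 1).
Proof.
move=> mu01; have i01 : fine (mu [set` `[0, 1]]) = 1 by rewrite mu01.
split=> x x01; apply/eqP; rewrite eq_le ?cdf_of_ge0 ?cdf_of_le1 ?andbT.
  suff : fine (mu [set` `[0, 1]]) + cdf_of mu x <= 1 by rewrite i01; lra.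
  apply: (@le_trans _ _ (fine (mu ([set` `[0, 1]] `|` [set` `]-oo, x]])))); last first.
    by rewrite -lee_fin EFin_fine_prob ?probability_le1//; exact: measurableU.
  rewrite -lee_fin EFinD /cdf_of !EFin_fine_prob//; last exact: measurableU.
  rewrite measureU//; apply/seteqP; split => y //=; rewrite !in_itv/=.
  by move=> [/andP[y0 _] yx]; move: (lt_le_trans x01 y0); rewrite ltNge yx.
rewrite -[leLHS]i01; apply: fine_prob_le => // y /=; rewrite !in_itv/=.
by move=> /andP[_ /le_trans]; apply.
Qed.

Lemma quantile_ge (R : realType) (F : R -> R) (u a : R) :
  u <= F 1 -> (forall v, 0 <= v <= 1 -> u <= F v -> a <= v) -> a <= quantile F u.
Proof.
move=> uF1 H; apply: lb_le_inf; first by exists 1 => /=; rewrite ler01 lexx.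
by move=> v [v01 uv]; exact: H.
Qed.

Lemma quantile_le (R : realType) (F : R -> R) (u v : R) :
  0 <= v <= 1 -> u <= F v -> quantile F u <= v.
Proof.
move=> v01 uv; apply: ge_inf; last by split.
by exists 0 => w [/andP[]].
Qed.

(* With q the harmonic mean of q1 < S(a) and q2 < S(b) with weights matching
   m = ((b-m)a + (m-a)b)/(b-a), concavity of the revenue gives quantile(1-q) >= m. *)
Lemma regular_harmonic (R : realType) (mu : probability R R) (a m b q1 q2 : R) :
  supported01 mu -> regular (cdf_of mu) -> 0 <= a -> a < m -> m < b -> b <= 1 ->
  0 < q1 < obs_prob mu true a -> 0 < q2 < obs_prob mu true b ->
  ((b - m) / q1 + (m - a) / q2)^-1 * (b - a) <= obs_prob mu true m.
Proof.
move=> mu01 reg a0 am mb b1 /andP[q10 q1a] /andP[q20 q2b].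
have [F0 F1] := supported_cdf mu01.
have sumo x := obs_prob_sum mu x.
have o0 x := obs_prob_ge0 mu false x.
have qge q x : 0 < q < obs_prob mu true x -> x <= quantile (cdf_of mu) (1 - q).
  move=> /andP[q0 qx]; apply: quantile_ge => [|v _ Fv].
    by rewrite F1// gerBl ltW.
  rewrite leNgt; apply/negP => vx; have := cdf_le_obs_false mu vx.
  by have := sumo x; move: Fv; lra.
set D := (b - m) / q1 + (m - a) / q2.
have D1 : 0 < (b - m) / q1 by rewrite divr_gt0 ?subr_gt0.
have D2 : 0 < (m - a) / q2 by rewrite divr_gt0 ?subr_gt0.
have D0 : 0 < D by rewrite addr_gt0.
have ba0 : 0 < b - a by lra.
set q := D^-1 * (b - a); have q0 : 0 < q by rewrite mulr_gt0 ?invr_gt0.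
pose l := (b - m) / q1 / D.
have l01 : 0 <= l <= 1.
  by rewrite /l divr_ge0 ?(ltW D0) ?(ltW D1)//= ler_pdivrMr// mul1r /D lerDl ltW.
have l1 : 1 - l = (m - a) / q2 / D.
  have <- : l + (m - a) / q2 / D = 1 by rewrite /l -mulrDl -/D divff ?gt_eqF.
  by rewrite addrC addKr.
have lq1 : l * q1 = (b - m) / D by rewrite /l; field; rewrite !gt_eqF.
have lq2 : (1 - l) * q2 = (m - a) / D by rewrite l1; field; rewrite !gt_eqF.
have qE : l * q1 + (1 - l) * q2 = q.
  by rewrite lq1 lq2 /q -mulrDl mulrC; congr (_ * _); ring.
have q11 : 0 <= q1 <= 1 by have := sumo a; have := o0 a; lra.
have q21 : 0 <= q2 <= 1 by have := sumo b; have := o0 b; lra.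
have := reg q1 q2 l q11 q21 l01; rewrite qE /revenue => H.
have Qm : m <= quantile (cdf_of mu) (1 - q).
  rewrite -(ler_pM2l q0); apply: le_trans H.
  rewrite !mulrA; apply: (@le_trans _ _ (l * q1 * a + (1 - l) * q2 * b)).
    rewrite lq1 lq2 /q le_eqVlt; apply/orP; left; apply/eqP; ring.
  have /andP[l0 _] := l01; rewrite lerD// ler_wpM2l ?qge ?q10 ?q20//.
    by rewrite mulr_ge0// ltW.
  by rewrite lq2 divr_ge0 ?subr_ge0// ltW.
suff : obs_prob mu false m <= 1 - q by have := sumo m; lra.
have q1le : q <= 1 by rewrite -qE; nra.
apply: obs_false_le => x xm; have [x0|x0] := ltP x 0; first by rewrite F0// subr_ge0.
rewrite leNgt; apply/negP => Fx.
have : quantile (cdf_of mu) (1 - q) <= x by apply: quantile_le; rewrite ?x0 ?ltW//; lra.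
lra.
Qed.

(** If F is flat to the left of a, the quantile of 1 - S(a) may fall below a. Hence the harmonic
    inequality is applied to the masses d S(a) and d S(b) with d < 1, and d then tends to 1. *)
Lemma regular_inv_convex (R : realType) (mu : probability R R) (a m b : R) :
  supported01 mu -> regular (cdf_of mu) -> 0 <= a -> a < m -> m < b ->
  0 < obs_prob mu true b ->
  (b - a) / obs_prob mu true m
    <= (b - m) / obs_prob mu true a + (m - a) / obs_prob mu true b.
Proof.
move=> mu01 reg a0 am mb Sb.
have [F0 F1] := supported_cdf mu01.
have b1 : b <= 1.
  rewrite leNgt; apply/negP => b1; have := cdf_le_obs_false mu b1.
  by have := obs_prob_sum mu b; rewrite F1//; lra.
have Sle x y : x < y -> obs_prob mu true y <= obs_prob mu true x.
  move=> xy; have := cdf_le_obs_false mu xy; have := obs_false_le_cdf mu x.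
  by have := obs_prob_sum mu x; have := obs_prob_sum mu y; lra.
have Sm : 0 < obs_prob mu true m by exact: lt_le_trans (Sle _ _ mb).
have Sa : 0 < obs_prob mu true a by exact: lt_le_trans (Sle _ _ am).
set A := obs_prob mu true a in Sa *; set B := obs_prob mu true b in Sb *.
set M := obs_prob mu true m in Sm *.
set T := (b - m) / A + (m - a) / B.
have T0 : 0 < T by rewrite addr_gt0// divr_gt0// subr_gt0.
have W d : 0 < d < 1 -> d * (b - a) <= M * T.
  move=> /andP[d0 d1].
  have := @regular_harmonic R mu a m b (d * A) (d * B) mu01 reg a0 am mb b1.
  rewrite !mulr_gt0// !gtr_pMl// => /(_ d1 d1).
  have -> : (b - m) / (d * A) + (m - a) / (d * B) = T / d.
    by rewrite /T; field; rewrite !gt_eqF.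
  by rewrite invf_div mulrAC ler_pdivrMr.
rewrite ler_pdivrMr// mulrC; apply/ler_addgt0Pr => e e0.
have ba : 0 < b - a by lra.
have [eb|be] := ltP e (b - a).
  have := W (1 - e / (b - a)); rewrite subr_gt0 ltr_pdivrMr// mul1r eb /=.
  rewrite ltrBlDr ltrDl divr_gt0// => /(_ isT).
  by rewrite mulrBl mul1r divfK ?gt_eqF// lerBlDr.
by apply: (le_trans be); rewrite lerDr mulr_ge0// ltW.
Qed.

Lemma regular_grid (R : realType) (mu : probability R R) (N : nat) :
  (0 < N)%N -> supported01 mu -> regular (cdf_of mu) ->
  inv_convex (fun k => obs_prob mu true (k%:R / N%:R)).
Proof.
move=> N0 mu01 reg; have NR : 0 < N%:R :> R by rewrite ltr0n.
split=> [k|i j|i j k /andP[ij jk] Sk].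
- rewrite obs_prob_ge0 andTb; have := obs_prob_sum mu (k%:R / N%:R).
  by have := obs_prob_ge0 mu false (k%:R / N%:R); lra.
- rewrite leq_eqVlt => /orP[/eqP ->//|ij].
  have ijR : (i%:R / N%:R) < (j%:R / N%:R) :> R by rewrite ltr_pM2r ?invr_gt0 ?ltr_nat.
  have := cdf_le_obs_false mu ijR; have := obs_false_le_cdf mu (i%:R / N%:R).
  have := obs_prob_sum mu (i%:R / N%:R); have := obs_prob_sum mu (j%:R / N%:R); lra.
have H := @regular_inv_convex R mu (i%:R / N%:R) (j%:R / N%:R) (k%:R / N%:R) mu01 reg.
rewrite !ltr_pM2r ?invr_gt0 ?ltr_nat ?divr_ge0// in H.
have E x y : (x < y)%N -> y%:R / N%:R - x%:R / N%:R = (y - x)%:R / N%:R :> R.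
  by move=> xy; rewrite natrB 1?ltnW// mulrBl.
have := H isT ij jk Sk; rewrite !E//; last exact: ltn_trans jk.
rewrite (mulrAC (k - i)%:R) (mulrAC (k - j)%:R) (mulrAC (j - i)%:R) -mulrDl.
by rewrite ler_pM2r ?invr_gt0.
Qed.

(** Moving from v to the next grid point is absorbed by the horizontal tolerance of the Levy
    distance, so F may rise arbitrarily fast between grid points. One inequality suffices: the other
    is the same with the measures exchanged, read at v - e. *)
Lemma levy_le_of_grid (R : realType) (mu mu' : probability R R) (N : nat) (e : R) :
  (0 < N)%N -> N%:R^-1 <= e -> supported01 mu -> supported01 mu' ->
  (forall k, (k <= N)%N ->
     `|obs_prob mu true (k%:R / N%:R) - obs_prob mu' true (k%:R / N%:R)| <= e) ->
  (levy (cdf_of mu) (cdf_of mu') <= e%:E)%E.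
Proof.
move=> N0 Ne s s' close; have NR : 0 < N%:R :> R by rewrite ltr0n.
have e0 : 0 < e by apply: lt_le_trans Ne; rewrite invr_gt0.
have half (nu nu' : probability R R) v : supported01 nu -> supported01 nu' ->
    (forall k, (k <= N)%N ->
      `|obs_prob nu true (k%:R / N%:R) - obs_prob nu' true (k%:R / N%:R)| <= e) ->
    cdf_of nu' v <= cdf_of nu (v + e) + e.
  move=> /supported_cdf[F0 F1] /supported_cdf[F'0 F'1] cl.
  have [v0|v0] := ltP v 0; first by rewrite F'0// addr_ge0 ?cdf_of_ge0 ?ltW.
  have [v1|v1] := leP 1 v.
    by rewrite F'1// F1 ?lerDl ?ltW//; lra.
  (* The first grid index strictly to the right of v, since P(V < k/N) has to include the mass at
     v. *)
  pose k := (Num.truncn (v * N%:R)).+1.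
  have vN : 0 <= v * N%:R by rewrite mulr_ge0 // ltW.
  have /andP[k1 k2] : k.-1%:R <= v * N%:R < k%:R by exact: truncn_itv.
  have kN : (k <= N)%N.
    rewrite -ltnS ltnS -(ltr_nat R); apply: (le_lt_trans k1).
    by rewrite -[ltRHS]mul1r ltr_pM2r.
  have vx : v < k%:R / N%:R by rewrite ltr_pdivlMr.
  have xv : k%:R / N%:R <= v + e.
    rewrite ler_pdivrMr// mulrDl -natr1 lerD//.
    by rewrite -ler_pdivrMr// div1r.
  have := cl _ kN; have := cdf_le_obs_false nu' vx.
  have := cdf_of_le nu xv; have := obs_false_le_cdf nu (k%:R / N%:R).
  have := obs_prob_sum nu (k%:R / N%:R); have := obs_prob_sum nu' (k%:R / N%:R).
  rewrite ler_norml => ? ? ? ? ? /andP[]; lra.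
apply: ereal_inf_lbound; exists e => // v; split; last exact: half.
rewrite lerBlDr; have := half mu' mu (v - e) s' s; rewrite subrK; apply => k kN.
by rewrite distrC close.
Qed.

(** * Adaptive observations *)

(* Expectation over the next n observations of an adaptive algorithm with history h. *)
Fixpoint expect (R : realType) (mu : probability R R) (price : seq bool -> R)
    (n : nat) (f : seq bool -> R) (h : seq bool) : R :=
  if n is n'.+1 then
    obs_prob mu true (price h) * expect mu price n' f (rcons h true) +
    obs_prob mu false (price h) * expect mu price n' f (rcons h false)
  else f h.

Lemma sum_tuple_cons (R : realType) (n : nat) (F : n.+1.-tuple bool -> R) :
  \sum_(b : n.+1.-tuple bool) F b =
  \sum_(b : n.-tuple bool) F (cons_tuple true b) +
  \sum_(b : n.-tuple bool) F (cons_tuple false b).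
Proof.
rewrite (reindex (fun p : bool * n.-tuple bool => cons_tuple p.1 p.2)) /=; last first.
  exists (fun b : n.+1.-tuple bool => (thead b, behead_tuple b)) => [[x b] _|b _] /=.
    by congr pair; apply: val_inj.
  by rewrite [RHS]tuple_eta; apply: val_inj.
rewrite -(pair_bigA _ (fun x b => F (cons_tuple x b))) /=.
by rewrite big_bool.
Qed.

Lemma expect_tuple (R : realType) (mu : probability R R) (price : seq bool -> R)
    (n : nat) (f : seq bool -> R) (h : seq bool) :
  \sum_(b : n.-tuple bool)
    (\prod_(i < n) obs_prob mu (tnth b i) (price (h ++ take i b))) * f (h ++ b)
  = expect mu price n f h.
Proof.
elim: n h => [|n IH] h /=.
  rewrite (big_pred1 [tuple]) => [|b]; last by rewrite [b]tuple0.
  by rewrite big_ord0 mul1r cats0.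
have E x : \sum_(b : n.-tuple bool)
    (\prod_(i < n.+1) obs_prob mu (tnth (cons_tuple x b) i)
       (price (h ++ take i (cons_tuple x b)))) * f (h ++ cons_tuple x b)
    = obs_prob mu x (price h) * expect mu price n f (rcons h x).
  rewrite -IH big_distrr; apply: eq_bigr => b _ /=.
  rewrite big_ord_recl tnth0 /= cats0 -!mulrA -cat_rcons; congr (_ * (_ * _)).
  by apply: eq_bigr => i _; rewrite tnthS -cat_rcons.
by rewrite sum_tuple_cons !E.
Qed.

Lemma det_success_expect (R : realType) n (price : seq bool -> R) out
    (mu : probability R R) eps :
  det_success n price out mu eps =
  expect mu price n (fun h => ((levy (cdf_of mu) (out h) <= eps%:E)%E)%:R) [::].
Proof. by rewrite -expect_tuple. Qed.

Lemma expect_le (R : realType) (mu : probability R R) price n (f g : seq bool -> R) h :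
  (forall h', size h' = (size h + n)%N -> f h' <= g h') ->
  expect mu price n f h <= expect mu price n g h.
Proof.
elim: n h => [|n IH] h fg /=; first by apply: fg; rewrite addn0.
by apply: lerD; rewrite ler_wpM2l ?obs_prob_ge0//; apply: IH => h' sh'; apply: fg;
  rewrite sh' size_rcons addnS.
Qed.

Lemma expectD (R : realType) (mu : probability R R) price n (f g : seq bool -> R) h :
  expect mu price n (fun x => f x + g x) h = expect mu price n f h + expect mu price n g h.
Proof. by elim: n h => //= n IH h; rewrite !IH; ring. Qed.

Lemma expectZ (R : realType) (mu : probability R R) price n (f : seq bool -> R) c h :
  expect mu price n (fun x => c * f x) h = c * expect mu price n f h.
Proof. by elim: n h => //= n IH h; rewrite !IH; ring. Qed.

Lemma expect_cst (R : realType) (mu : probability R R) price n c h :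
  expect mu price n (fun=> c) h = c.
Proof. by elim: n h => //= n IH h; rewrite !IH -mulrDl obs_prob_sum mul1r. Qed.

Lemma expect_sum (R : realType) (mu : probability R R) price n (K : nat)
    (f : nat -> seq bool -> R) h :
  expect mu price n (fun x => \sum_(k < K) f k x) h = \sum_(k < K) expect mu price n (f k) h.
Proof.
elim: K => [|K IH].
  rewrite big_ord0 -[RHS](expect_cst mu price n 0 h).
  by congr (expect _ _ _ _ _); apply/funext => x; rewrite big_ord0.
rewrite big_ord_recr /= -IH -expectD; congr (expect _ _ _ _ _).
by apply/funext => x; rewrite big_ord_recr.
Qed.

Lemma expect_supermartingale (R : realType) (mu : probability R R) price n
    (f : seq bool -> R) h :
  (forall h, obs_prob mu true (price h) * f (rcons h true) +
             obs_prob mu false (price h) * f (rcons h false) <= f h) ->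
  expect mu price n f h <= f h.
Proof.
move=> fm; elim: n h => //= n IH h; apply: le_trans (fm h).
by apply: lerD; rewrite ler_wpM2l ?obs_prob_ge0.
Qed.

(** * Concentration by an exponential supermartingale *)

Lemma expR_le_quadratic (R : realType) (x : R) : x <= 1 / 2 -> expR x <= 1 + x + 2 * x ^+ 2.
Proof.
move=> x2; have := expR_ge1Dx (- x); rewrite expRN => H.
have E0 := expR_gt0 x; have : (1 - x) * expR x <= 1 by rewrite -ler_pdivlMr// div1r.
have P : 1 <= (1 - x) * (1 + x + 2 * x ^+ 2).
  have : 0 <= x ^+ 2 * (1 - 2 * x) by rewrite mulr_ge0 ?sqr_ge0//; lra.
  lra.
by move=> /le_trans/(_ P); rewrite ler_pM2l//; lra.
Qed.

(** The quadratic bound on the exponential gives a mean of at most 1 + 2 l^2 p(1-p) <= 1 + l^2 <=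
    exp(l^2) before normalisation. *)
Lemma bernoulli_mgf (R : realType) (p l : R) : 0 <= p <= 1 -> `|l| <= 1 / 2 ->
  p * expR (l * (1 - p) - l ^+ 2) + (1 - p) * expR (l * (0 - p) - l ^+ 2) <= 1.
Proof.
move=> /andP[p0 p1]; rewrite ler_norml => /andP[l1 l2].
rewrite !expRD !mulrA -mulrDl expRN ler_pdivrMr ?expR_gt0// mul1r.
have [q0 l0] : 0 <= 1 - p /\ 0 <= l ^+ 2 by split; [lra|exact: sqr_ge0].
have A : p * expR (l * (1 - p)) <= p * (1 + l * (1 - p) + 2 * (l * (1 - p)) ^+ 2).
  by rewrite ler_wpM2l// expR_le_quadratic//; nra.
have B : (1 - p) * expR (l * (0 - p)) <=
    (1 - p) * (1 + l * (0 - p) + 2 * (l * (0 - p)) ^+ 2).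
  by rewrite ler_wpM2l// expR_le_quadratic//; nra.
apply: le_trans (lerD A B) _; apply: le_trans (expR_ge1Dx _).
have : 0 <= l ^+ 2 * (1 - 2 * (p * (1 - p))) by rewrite mulr_ge0//; nra.
lra.
Qed.

Definition deviation (R : realType) (mu : probability R R) (price : seq bool -> R)
    (chi : pred nat) (h : seq bool) : R :=
  \sum_(0 <= i < size h | chi i)
    ((nth false h i)%:R - obs_prob mu true (price (take i h))).

(** Each round selected by [chi] is discounted by exp(-l^2), the factor that makes this a
    supermartingale whatever the adaptive prices are. *)
Definition exp_deviation (R : realType) (mu : probability R R) (price : seq bool -> R)
    (chi : pred nat) (l : R) (h : seq bool) : R :=
  expR (l * deviation mu price chi h - l ^+ 2 * \sum_(0 <= i < size h | chi i) 1).

Lemma deviation_rcons (R : realType) (mu : probability R R) price (chi : pred nat) h x :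
  deviation mu price chi (rcons h x) = deviation mu price chi h +
    (if chi (size h) then x%:R - obs_prob mu true (price h) else 0).
Proof.
rewrite /deviation size_rcons big_mkcond big_nat_recr//= [in RHS]big_mkcond/=.
rewrite nth_rcons ltnn eqxx -cats1 take_size_cat//; congr (_ + _).
apply: eq_big_nat => i /andP[_ ih].
by rewrite nth_cat ih takel_cat// ltnW.
Qed.

Lemma expect_exp_deviation (R : realType) (mu : probability R R) price n
    (chi : pred nat) (l : R) :
  `|l| <= 1 / 2 -> expect mu price n (exp_deviation mu price chi l) [::] <= 1.
Proof.
move=> l2; apply: (@le_trans _ _ (exp_deviation mu price chi l [::])); last first.
  by rewrite /exp_deviation /deviation !big_geq// !mulr0 subr0 expR0.
apply: expect_supermartingale => h.
have E x : exp_deviation mu price chi l (rcons h x) = exp_deviation mu price chi l h *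
    (if chi (size h) then expR (l * (x%:R - obs_prob mu true (price h)) - l ^+ 2) else 1).
  rewrite /exp_deviation deviation_rcons size_rcons [X in _ - _ * X]big_mkcond.
  rewrite big_nat_recr//= -big_mkcond.
  case: ifP => _; last by rewrite !addr0 mulr1.
  by rewrite -expRD; congr expR; ring.
have S := obs_prob_sum mu (price h).
have S1 : obs_prob mu false (price h) = 1 - obs_prob mu true (price h) by lra.
have Psi0 : 0 <= exp_deviation mu price chi l h by exact: expR_ge0.
rewrite !E; case: ifP => _; last by rewrite !mulr1 -mulrDl S mul1r.
rewrite -[leRHS]mulr1 !(mulrCA (obs_prob mu _ _)) -mulrDr ler_wpM2l// S1.
apply: bernoulli_mgf => //; rewrite obs_prob_ge0 andTb.
by have := obs_prob_ge0 mu false (price h); lra.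
Qed.

Lemma big_block (R : realType) (F : nat -> R) (k m n : nat) : (k.+1 * m <= n)%N ->
  \sum_(0 <= i < n | (k * m <= i < k.+1 * m)%N) F i = \sum_(k * m <= i < k.+1 * m) F i.
Proof.
move=> kn; rewrite [RHS](big_nat_widen _ _ n)// [RHS](big_nat_widenl _ 0)//.
by apply: eq_bigl => i; rewrite andbC.
Qed.

(** Chernoff bound with a union over the blocks, as a pointwise minorant: g is at least 1 - c times
    the sum of all [Psi k]. On a good history g >= 1; on a bad one some [Psi k] is at least 1/c and
    the minorant is not positive. Each [Psi k] has expectation at most 2, one for each sign. *)
Lemma block_concentration (R : realType) (mu : probability R R) price (K m : nat) (t : R)
    (g : seq bool -> R) :
  0 < t <= 1 -> (forall h, 0 <= g h) ->
  (forall h, size h = (K * m)%N ->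
    (forall k, (k < K)%N ->
      `|deviation mu price (fun i => (k * m <= i < k.+1 * m)%N) h| <= m%:R * t) ->
    1 <= g h) ->
  1 - 2 * K%:R * expR (- (m%:R * t ^+ 2 / 4)) <= expect mu price (K * m) g [::].
Proof.
move=> /andP[t0 t1] g0 good.
pose chi k i := (k * m <= i < k.+1 * m)%N.
(* l = t/2 maximises l m t - l^2 m; the maximum is m t^2/4. *)
pose l := t / 2; pose c := expR (- (m%:R * t ^+ 2 / 4)).
pose Psi k h := exp_deviation mu price (chi k) l h + exp_deviation mu price (chi k) (- l) h.
have l2 : `|l| <= 1 / 2 by rewrite ger0_norm /l; lra.
have c0 : 0 < c by exact: expR_gt0.
have Psi0 k h : 0 <= Psi k h by rewrite addr_ge0// expR_ge0.
apply: (@le_trans _ _ (expect mu price (K * m)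
  (fun h => 1 + - c * \sum_(k < K) Psi k h) [::])).
  rewrite expectD expect_cst expectZ expect_sum.
  suff /(ler_wpM2l (ltW c0)) : \sum_(k < K) expect mu price (K * m) (Psi k) [::] <= K%:R * 2.
    by rewrite -/c; lra.
  apply: (@le_trans _ _ (\sum_(k < K) (2 : R))); last first.
    by rewrite sumr_const card_ord mulr_natl.
  apply: ler_sum => k _; rewrite /Psi expectD -[2]/(1 + 1).
  by rewrite lerD// expect_exp_deviation// normrN.
apply: expect_le => h sh; rewrite add0n in sh.
have [H|] := pselect (forall k, (k < K)%N ->
  `|deviation mu price (chi k) h| <= m%:R * t).
  apply: le_trans (good h sh H).
  by rewrite gerDl mulNr oppr_le0 mulr_ge0 ?(ltW c0)// sumr_ge0.
move=> /existsNP[k /not_implyP[kK /negP]]; rewrite -ltNge => dev.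
apply: le_trans (g0 h); rewrite mulNr subr_le0.
suff : c^-1 <= \sum_(k < K) Psi k h by move=> /(ler_wpM2l (ltW c0)); rewrite divff ?gt_eqF.
rewrite (bigD1 (Ordinal kK))//=; apply: ler_wpDr; first exact: sumr_ge0.
have cnt : \sum_(0 <= i < size h | chi k i) 1 = m%:R :> R.
  rewrite big_block ?sh ?leq_mul2r ?kK ?orbT// big_const_nat mulSn addnK iter_addr_0.
  by [].
have E : m%:R * t ^+ 2 / 4 = l * (m%:R * t) - l ^+ 2 * m%:R by rewrite /l; field.
rewrite /c -expRN opprK E /Psi /exp_deviation cnt.
have l0 : 0 < l by rewrite /l; lra.
move: dev; rewrite /deviation -/(deviation mu price (chi k) h) ltr_normr => /orP[d|d].
  by apply: ler_wpDr; rewrite ?expR_ge0// ler_expR lerD2r ler_pM2l// ltW.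
apply: ler_wpDl; rewrite ?expR_ge0// ler_expR sqrrN lerD2r mulNr -mulrN.
by rewrite ler_pM2l// ltW.
Qed.

(** * The upper bound *)

Definition block_mean (R : realType) (m : nat) (h : seq bool) (k : nat) : R :=
  (\sum_(k * m <= i < k.+1 * m) (nth false h i)%:R) / m%:R.

Definition block_transcript (R : realType) (L m : nat) (t : R) (h : seq bool) :=
  transcript (next_point L t) (block_mean R m h).

(* Every grid point chosen by the bisection is queried m times in a row, and the
   frequency of the positive answers is the estimate recorded in the transcript. *)
Definition block_price (R : realType) (L m : nat) (t : R) (h : seq bool) : R :=
  (next_point L t (block_transcript L m t h (size h %/ m)))%:R / (2 ^ L)%:R.

Definition explains (R : realType) (L : nat) (t : R) (tr : seq (nat * R))
    (mu : probability R R) : Prop :=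
  [/\ supported01 mu, regular (cdf_of mu) &
      accurate t (fun k => obs_prob mu true (k%:R / (2 ^ L)%:R)) tr].

(** When the transcript is accurate the true distribution is itself a candidate, so the default
    output 0 can only occur on the failure event. *)
Definition some_explanation (R : realType) (L : nat) (t : R) (tr : seq (nat * R)) : R -> R :=
  if pselect (exists mu, explains L t tr mu) is left H then cdf_of (projT1 (cid H))
  else fun=> 0.

(** Causality: the first k estimates use only the observations before k m, so the price is constant
    on a block and may be read off the full history. *)
Lemma block_price_take (R : realType) (L m : nat) (t : R) (h : seq bool) (k i : nat) :
  (i <= size h)%N -> (k * m <= i < k.+1 * m)%N ->
  block_price L m t (take i h)
  = (next_point L t (block_transcript L m t h k))%:R / (2 ^ L)%:R.
Proof.
move=> ih /andP[ki ik]; have m0 : (0 < m)%N by case: m ki ik; rewrite ?muln0.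
have ik' : (i %/ m = k)%N.
  by apply/eqP; rewrite eqn_leq -ltnS ltn_divLR// ik leq_divRL.
rewrite /block_price size_takel// ik'; congr ((next_point _ _ _)%:R / _).
rewrite /block_transcript; elim: k {ik ik'} ki => //= k IH ki.
have ki' : (k * m <= i)%N by rewrite (leq_trans _ ki)// leq_mul2r leqnSn orbT.
rewrite (IH ki'); congr (rcons _ (_, _)); congr (_ / _).
by apply: eq_big_nat => j /andP[_ jk]; rewrite nth_take// (leq_trans jk).
Qed.

Lemma block_accurate (R : realType) (L m K : nat) (t : R) (mu : probability R R)
    (h : seq bool) :
  (0 < m)%N -> size h = (K * m)%N ->
  (forall k, (k < K)%N ->
    `|deviation mu (block_price L m t) (fun i => (k * m <= i < k.+1 * m)%N) h|
      <= m%:R * t) ->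
  accurate t (fun k => obs_prob mu true (k%:R / (2 ^ L)%:R)) (block_transcript L m t h K).
Proof.
move=> m0 sh dev; have mR : 0 < m%:R :> R by rewrite ltr0n.
have {}dev k : (k < K)%N -> `|obs_prob mu true
    ((next_point L t (block_transcript L m t h k))%:R / (2 ^ L)%:R) - block_mean R m h k| <= t.
  move=> kK; have := dev k kK; rewrite /deviation big_block ?sh ?leq_mul2r ?kK ?orbT//.
  have kKm : (k.+1 * m <= K * m)%N by rewrite leq_mul2r kK orbT.
  rewrite (eq_big_nat _ _ (F2 := fun i => (nth false h i)%:R - obs_prob mu true
    ((next_point L t (block_transcript L m t h k))%:R / (2 ^ L)%:R))); last first.
    move=> i ki; rewrite (@block_price_take R L m t h k i)//.
    by have /andP[_ ik] := ki; rewrite sh ltnW// (leq_trans ik).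
  rewrite sumrB big_const_nat iter_addr_0 mulSn addnK -[_ *+ m]mulr_natl => H.
  rewrite -(ler_pM2l mR) -{1}(ger0_norm (ltW mR)) -normrM mulrBr distrC.
  by rewrite /block_mean (mulrC _ (_ / _)) divfK ?gt_eqF.
rewrite /block_transcript in dev *; elim: K {sh} dev => [|K IH] dev v a //=.
rewrite mem_rcons inE => /orP[/eqP[-> ->]|]; first exact: dev.
by apply: IH => k kK; apply: dev; exact: ltnW.
Qed.

Lemma some_explanation_close (R : realType) (sg t e : R) (L K : nat) (ans : nat -> R)
    (mu : probability R R) :
  (0 < L)%N -> 0 < t -> 0 < sg -> sg <= 1 / 2 -> sg ^+ 2 <= 10 * t ->
  3 + L%:R * ((1 + 2 / sg * (2 * `|ln (7 * t)^-1| + 1)) * 2) < K%:R ->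
  216 * t <= e -> (2 ^ L)%:R^-1 <= e ->
  explains L t (transcript (next_point L t) ans K) mu ->
  (levy (cdf_of mu) (some_explanation L t (transcript (next_point L t) ans K)) <= e%:E)%E.
Proof.
move=> L0 t0 sg0 sg2 sgt KQ te Le ex; have [mu01 mur muacc] := ex.
rewrite /some_explanation; case: pselect => [H|]; last by case; exists mu.
case: (cid H) => nu /= [nu01 nur nuacc].
have N0 : (0 < 2 ^ L)%N by rewrite expn_gt0.
apply: (levy_le_of_grid N0) => // k kN.
have mc := regular_grid N0 mu01 mur; have nc := regular_grid N0 nu01 nur.
have A := bisection_close L0 t0 sg0 sg2 sgt KQ mc nc muacc nuacc kN.
have B := bisection_close L0 t0 sg0 sg2 sgt KQ nc mc nuacc muacc kN.
rewrite ler_norml; apply/andP; split; lra.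
Qed.

Lemma block_success (R : realType) (sg t e : R) (L K m : nat) (mu : probability R R) :
  (0 < L)%N -> (0 < m)%N -> 0 < t <= 1 -> 0 < sg -> sg <= 1 / 2 -> sg ^+ 2 <= 10 * t ->
  3 + L%:R * ((1 + 2 / sg * (2 * `|ln (7 * t)^-1| + 1)) * 2) < K%:R ->
  216 * t <= e -> (2 ^ L)%:R^-1 <= e -> supported01 mu -> regular (cdf_of mu) ->
  1 - 2 * K%:R * expR (- (m%:R * t ^+ 2 / 4)) <=
  det_success (K * m) (block_price L m t)
    (fun h => some_explanation L t (block_transcript L m t h K)) mu e.
Proof.
move=> L0 m0 t01 sg0 sg2 sgt KQ te Le mu01 reg; have /andP[t0 _] := t01.
rewrite det_success_expect; apply: block_concentration => // h sh dev.
have acc := block_accurate m0 sh dev.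
by rewrite (some_explanation_close L0 t0 sg0 sg2 sgt KQ te Le).
Qed.

(** * Choice of the parameters *)

Lemma ln2_ge_half (R : realType) : 1 / 2 <= ln (2 : R).
Proof. by have := @ln_ge_1BV R 2 (ltr0Sn _ _); lra. Qed.

Lemma exp2_ge (R : realType) (y : R) (L : nat) : 0 < y -> 2 * ln y <= L%:R -> y <= 2 ^+ L.
Proof.
move=> y0 yL; rewrite -ler_ln ?posrE ?exprn_gt0// lnXn// -[ln _ *+ _]mulr_natl.
have : L%:R * (1 / 2) <= L%:R * ln (2 : R) by rewrite ler_wpM2l// ln2_ge_half.
lra.
Qed.

Lemma trunc_bounds (R : realType) (x : R) :
  0 <= x -> x < (Num.truncn x).+1%:R /\ (Num.truncn x).+1%:R <= x + 1.
Proof.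
move=> x0; have /andP[x1 x2] := Num.Theory.truncn_itv x0.
by rewrite x2 -natr1 lerD2r.
Qed.

(* The numerical constants are crude; only the powers of eps and ln(1/eps) matter. *)
Lemma query_budget (R : realType) : exists C : R, 0 < C /\
  forall e : R, 0 < e < 1 / 2 -> exists L K m : nat,
  [/\ (0 < L)%N, (0 < m)%N, (2 ^ L)%:R^-1 <= e,
      3 + L%:R * ((1 + 2 / (Num.sqrt e / 5)
          * (2 * `|ln (7 * (e / 216))^-1| + 1)) * 2) < (K%:R : R) &
      2 * K%:R * expR (- (m%:R * (e / 216) ^+ 2 / 4)) <= e /\
      (K * m)%:R <= C * (Num.sqrt e ^+ 5)^-1 * ln e^-1 ^+ 3].
Proof.
have [C3 [C30 C3ge]] : exists C3 : R, 0 < C3 /\ 160 * 100 <= C3.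
  by exists (160 * 100); split; [rewrite mulr_gt0|exact: lexx].
have [C4 [C40 C4ge]] : exists C4 : R, 0 < C4 /\ 4 * C3 + 4 <= C4.
  by exists (4 * C3 + 4); split=> //; lra.
(* With t = e/216, W/e^2 equals 4/t^2. Taking m above (4/t^2) ln (2K/e) makes the failure
   probability 2K exp(-m t^2/4) at most e. *)
have [W [W0 WE]] : exists W : R, 0 < W /\ W = 4 * (216 * 216).
  by exists (4 * (216 * 216)); split; [lra|].
have [C5 [C50 C5ge]] : exists C5 : R, 0 < C5 /\ W * C4 + 4 <= C5.
  by exists (W * C4 + 4); split; [rewrite addr_gt0 ?mulr_gt0|exact: lexx].
exists (C3 * C5); split; first by rewrite mulr_gt0.
move=> e /andP[e0 e2]; set l := ln e^-1.
have ei2 : 2 <= e^-1 by rewrite -[2]invrK lef_pV2 ?posrE//; lra.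
have ei0 : 0 < e^-1 by rewrite invr_gt0.
have l12 : 1 / 2 <= l.
  by apply: le_trans (ln2_ge_half R) _; rewrite ler_ln ?posrE.
have l0 : 0 < l by lra.
have le1 : l <= e^-1 by have := ln_le_subr1 ei0; rewrite -/l; lra.
set x := Num.sqrt e; have x0 : 0 < x by rewrite sqrtr_gt0.
have xx : x ^+ 2 = e by rewrite sqr_sqrtr// ltW.
pose y := x^-1; have y0 : 0 < y by rewrite invr_gt0.
have yy : y ^+ 2 = e^-1 by rewrite exprVn xx.
have y1 : 1 <= y by rewrite -(@expr_ge1 _ 2)// ?ltW// yy; lra.
have yle : y <= e^-1 by rewrite -yy expr2 ler_peMl// ltW.
have [L1 L2] := @trunc_bounds R (2 * l + 1) ltac:(lra).
set L := (Num.truncn (2 * l + 1)).+1 in L1 L2 *.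
pose Q : R := 3 + L%:R * ((1 + 2 / (x / 5) * (2 * `|ln (7 * (e / 216))^-1| + 1)) * 2).
have Lnn : `|ln (7 * (e / 216))^-1| <= 61 * l.
  have -> : (7 * (e / 216))^-1 = 216 / 7 * e^-1 by field; rewrite gt_eqF.
  rewrite lnM; [|by rewrite posrE divr_gt0 ?ltr0n|by rewrite posrE].
  rewrite -/l.
  have := @ln_le_subr1 R (216 / 7) ltac:(lra).
  have : 0 <= ln (216 / 7 : R) by rewrite ln_ge0//; lra.
  move: l0 l12; clear => ? ? ? ?; rewrite ger0_norm; lra.
have Q0 : 0 <= Q.
  have N0 : 0 <= 2 * `|ln (7 * (e / 216))^-1| + 1 by rewrite addr_ge0 ?mulr_ge0.
  have x50 : 0 <= 2 / (x / 5) by rewrite !divr_ge0// ltW.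
  by apply: addr_ge0 => //; do 2 apply: mulr_ge0 => //; rewrite addr_ge0// mulr_ge0.
have Qle : Q + 1 <= C3 * (l ^+ 2 * y).
  have -> : Q = 3 + L%:R * ((1 + 10 * y * (2 * `|ln (7 * (e / 216))^-1| + 1)) * 2).
    by rewrite /Q /y; field; rewrite gt_eqF.
  set N := `|_| in Lnn *.
  have l1 : 1 <= 2 * l by move: l12; clear; lra.
  have A : (1 + 10 * y * (2 * N + 1)) * 2 <= 25 * 100 * (l * y).
    have : 10 * y * (2 * N + 1) <= 10 * y * (124 * l).
      rewrite ler_wpM2l ?mulr_ge0 ?(ltW y0)//; move: Lnn l1; clear; lra.
    have : 1 * 1 <= 2 * l * y by apply: ler_pM.
    clear; lra.
  have B : L%:R * ((1 + 10 * y * (2 * N + 1)) * 2) <= 6 * l * (25 * 100 * (l * y)).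
    rewrite ler_pM// ?ler0n//; last lra.
    apply: mulr_ge0 => //; apply: addr_ge0 => //; apply: mulr_ge0.
      by rewrite mulr_ge0// ltW.
    by rewrite addr_ge0// mulr_ge0// normr_ge0.
  have ly : 4 <= 16 * (l ^+ 2 * y).
    have l2 : 1 <= 2 * l * (2 * l) by rewrite -[leLHS]mulr1; apply: ler_pM.
    have : 1 * 1 <= (2 * l * (2 * l)) * y by apply: ler_pM.
    by clear; lra.
  have : 160 * 100 * (l ^+ 2 * y) <= C3 * (l ^+ 2 * y).
    by rewrite ler_wpM2r// mulr_ge0 ?sqr_ge0 ?ltW.
  by move: B ly; clear; lra.
have [K1 K2] := trunc_bounds Q0.
set K := (Num.truncn Q).+1 in K1 K2 *.
have K0 : 0 < K%:R :> R by rewrite ltr0n.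
have KC : K%:R <= C3 * (l ^+ 2 * y) by exact: le_trans K2 Qle.
pose Z : R := ln (2 * K%:R / e).
have z0 : 0 < 2 * K%:R / e by rewrite divr_gt0 ?mulr_gt0.
have K1R : 1 <= K%:R :> R by rewrite ler1n.
have Z0 : 0 <= Z.
  by rewrite /Z ln_ge0// ler_pdivlMr// mul1r; lra.
have ZC : Z <= C4 * l.
  have H : 2 * K%:R / e <= 2 * C3 * e^-1 ^+ 4.
    have ll : l ^+ 2 * y <= e^-1 ^+ 3.
      rewrite [leRHS]exprSr; apply: ler_pM => //; first exact: sqr_ge0.
        exact: ltW.
      by rewrite lerXn2r// nnegrE ltW.
    have : C3 * (l ^+ 2 * y) <= C3 * e^-1 ^+ 3 by rewrite ler_pM2l.
    move=> /(le_trans KC) KC'.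
    by rewrite [e^-1 ^+ 4]exprSr mulrA ler_pM2r// -[leRHS]mulrA ler_pM2l.
  have : Z <= ln (2 * C3 * e^-1 ^+ 4).
    by rewrite ler_ln ?posrE ?mulr_gt0 ?exprn_gt0.
  rewrite lnM ?posrE ?mulr_gt0 ?exprn_gt0// lnXn// -/l -[l *+ _]mulr_natl.
  have := @ln_le_subr1 R (2 * C3) ltac:(lra).
  have : (4 * C3 + 4) * l <= C4 * l by rewrite ler_pM2r.
  have : 2 * C3 * 1 <= 2 * C3 * (2 * l).
    by rewrite ler_pM2l ?mulr_gt0//; move: l12; clear; lra.
  by clear; lra.
have E2 : 0 < e^-1 ^+ 2 by rewrite exprn_gt0.
have T0 : 0 <= W * e^-1 ^+ 2 * Z.
  by rewrite !mulr_ge0 // ltW.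
have [m1 m2] := trunc_bounds T0.
set m := (Num.truncn _).+1 in m1 m2 *.
have mC : m%:R <= C5 * (l * e^-1 ^+ 2).
  have H1 : W * e^-1 ^+ 2 * Z <= W * e^-1 ^+ 2 * (C4 * l).
    by rewrite ler_wpM2l// mulr_ge0 ?ltW.
  have l2 : 1 <= 2 * l by move: l12; clear; lra.
  have H2 : 1 * 1 <= 2 * l * e^-1 ^+ 2.
    by apply: ler_pM => //; rewrite expr_ge1 ?(ltW ei0)//; move: ei2; clear; lra.
  have H3 : (W * C4 + 4) * (l * e^-1 ^+ 2) <= C5 * (l * e^-1 ^+ 2).
    by rewrite ler_pM2r// mulr_gt0.
  have H4 : 0 <= l * e^-1 ^+ 2 by rewrite mulr_ge0 ?ltW.
  by move: m2 H1 H2 H3 H4; clear; lra.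
exists L, K, m; split=> //.
  rewrite natrX -[leRHS]invrK lef_pV2 ?posrE ?exprn_gt0//.
  by apply: exp2_ge => //; rewrite -/l; lra.
split.
  have : Z <= m%:R * (e / 216) ^+ 2 / 4.
    have V0 : 0 < (e / 216) ^+ 2 / 4.
      apply: divr_gt0; last by rewrite ltr0n.
      by apply: exprn_gt0; apply: divr_gt0; last rewrite ltr0n.
    rewrite -mulrA -ler_pdivrMr//; apply: le_trans (ltW m1).
    rewrite le_eqVlt; apply/orP; left; apply/eqP.
    by rewrite WE; field; rewrite gt_eqF.
  move=> ZX; have : expR (- (m%:R * (e / 216) ^+ 2 / 4)) <= expR (- Z).
    by rewrite ler_expR lerN2.
  rewrite [expR (- Z)]expRN /Z lnK ?posrE// invf_div => H.
  by rewrite mulrC -ler_pdivlMr ?mulr_gt0.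
(* The three logarithms come from the number of levels, from the curved triples of one level and
   from the block length. *)
rewrite natrM; apply: (@le_trans _ _ (C3 * (l ^+ 2 * y) * (C5 * (l * e^-1 ^+ 2)))).
  by rewrite ler_pM.
rewrite -yy /y -exprVn le_eqVlt; apply/orP; left; apply/eqP; ring.
Qed.

Lemma pricing_query_upper_bound (R : realType) :
  exists (C : R) (k : nat), 0 < C /\
    forall eps : R, 0 < eps < 1 / 2 ->
      exists n : nat,
        n%:R <= C * (Num.sqrt eps ^+ 5)^-1 * ln (eps^-1) ^+ k /\
        exists (d : measure_display) (Omega : measurableType d)
               (P : probability Omega R)
               (price : Omega -> seq bool -> R) (out : Omega -> seq bool -> R -> R),
          measurable_alg n price out /\
          forall mu : probability R R, supported01 mu -> regular (cdf_of mu) ->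
            ((1 - eps)%:E <= success P n price out mu eps)%E.
Proof.
have [C [C0 budget]] := query_budget R.
exists C, 3; split=> // e e01; have /andP[e0 e2] := e01.
have [L [K [m [L0 m0 Le KQ [fail nC]]]]] := budget e e01.
exists (K * m)%N; split=> //.
pose t := e / 216.
(* The algorithm is deterministic: its internal randomness is a point mass. *)
exists _, (measurableTypeR R), (@dirac _ (measurableTypeR R) 0 R).
exists (fun=> block_price L m t),
  (fun _ h => some_explanation L t (block_transcript L m t h K)).
split=> [mu eps|mu mu01 reg]; first exact: measurable_cst.
rewrite /success integral_cst//= diracT mule1 lee_fin.
have x0 : 0 < Num.sqrt e by rewrite sqrtr_gt0.
have xx : Num.sqrt e ^+ 2 = e by rewrite sqr_sqrtr// ltW.
have x1 : Num.sqrt e <= 1 by rewrite -(@expr_le1 _ 2)// ?ltW// xx; lra.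
have t0 : 0 < t by rewrite divr_gt0 ?ltr0n.
have tE : 216 * t = e by rewrite /t; field.
(* sg = sqrt(e)/5 is admissible because sg^2 = e/25 <= 10 e/216 = 10 t. *)
apply: le_trans (block_success (sg := Num.sqrt e / 5) L0 m0 _ _ _ _ KQ _ Le mu01 reg).
- by rewrite lerD2l lerN2.
- by rewrite t0; lra.
- by rewrite divr_gt0.
- by lra.
- by rewrite exprMn xx; lra.
- by rewrite -/t tE.
Qed.

(** * The lower bound: a family of hard distributions *)

Lemma exists_probability_of_cdf (R : realType) (F : R -> R) :
  nondecreasing F -> right_continuous F -> F x @[x --> -oo] --> (0 : R) ->
  F x @[x --> +oo] --> (1 : R) ->
  exists mu : probability R R, cdf_of mu = F.
Proof.
move=> nd rc F0 F1.
pose f : cumulativeBounded (0 : R) (1 : R) :=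
  HB.pack F (isCumulative.Build R _ R F nd rc) (isCumulativeBounded.Build R 0 1 F F0 F1).
pose P : probability (measurableTypeR R) R := lebesgue_stieltjes_measure f.
pose X : {RV P >-> R} := HB.pack (idfun : measurableTypeR R -> R)
  (@isMeasurableFun.Build _ _ (measurableTypeR R) R (idfun : measurableTypeR R -> R)
     (@measurable_id _ (measurableTypeR R) setT)).
exists (distribution P X); apply/funext => x.
have H : distribution P X [set` `]-oo, x]] = (F x)%:E := cdf_lebesgue_stieltjes_id f x.
exact: (congr1 fine H).
Qed.

(* Convex profile g for which F = 1 - 1/g on [0, 1[ is regular: the parabola
   1 + v + v^2, replaced on [a, b] by its chord. *)
Definition chord_profile (R : realType) (a b v : R) : R :=
  Num.max (1 + v + v ^+ 2) (1 + (1 + a + b) * v - a * b).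

(** The mass 1/g(1) left over is an atom at 1. The base distribution is obtained from the degenerate
    window a = b = 1/2, whose chord is a tangent and stays below the parabola. *)
Definition hard_cdf (R : realType) (a b x : R) : R :=
  if x < 1 then 1 - (chord_profile a b (Num.max x 0))^-1 else 1.

Lemma chord_profileE (R : realType) (a b v : R) :
  chord_profile a b v = 1 + v + v ^+ 2 + Num.max 0 ((v - a) * (b - v)).
Proof. by rewrite /chord_profile addr_maxr addr0; congr Num.max; ring. Qed.

Lemma chord_profile0 (R : realType) (a b : R) : 0 <= a -> 0 <= b -> chord_profile a b 0 = 1.
Proof.
move=> a0 b0; rewrite chord_profileE max_l; first by ring.
by rewrite sub0r subr0 mulNr oppr_le0 mulr_ge0.
Qed.

Lemma chord_profile_lt (R : realType) (a b x y : R) :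
  0 <= a -> 0 <= b -> 0 <= x -> x < y -> chord_profile a b x < chord_profile a b y.
Proof.
move=> a0 b0 x0 xy; rewrite /chord_profile gt_max !lt_max; apply/andP; split.
  by apply/orP; left; nra.
apply/orP; right; have : 0 < (1 + a + b) * (y - x) by rewrite mulr_gt0; lra.
lra.
Qed.

Lemma chord_profile_ge1 (R : realType) (a b x : R) : 0 <= x -> 1 <= chord_profile a b x.
Proof. by move=> x0; rewrite /chord_profile le_max; apply/orP; left; nra. Qed.

Lemma chord_profile_lipschitz (R : realType) (a b x y : R) :
  0 <= a <= 1 -> 0 <= b <= 1 -> 0 <= x -> x <= y -> y <= 1 ->
  chord_profile a b y <= chord_profile a b x + 3 * (y - x).
Proof.
move=> /andP[a0 a1] /andP[b0 b1] x0 xy y1; rewrite {1}/chord_profile ge_max.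
have H1 : 1 + x + x ^+ 2 <= chord_profile a b x by rewrite le_max lexx.
have H2 : 1 + (1 + a + b) * x - a * b <= chord_profile a b x.
  by rewrite le_max lexx orbT.
apply/andP; split.
  have : 0 <= (y - x) * (2 - x - y) by rewrite mulr_ge0; lra.
  nra.
have : 0 <= (y - x) * (2 - a - b) by rewrite mulr_ge0; lra.
nra.
Qed.

Lemma chord_profile_convex (R : realType) (a b x y t : R) : 0 <= t <= 1 ->
  chord_profile a b (t * x + (1 - t) * y)
    <= t * chord_profile a b x + (1 - t) * chord_profile a b y.
Proof.
move=> /andP[t0 t1]; rewrite {1}/chord_profile ge_max.
have t1' : 0 <= 1 - t by lra.
have H1 z : 1 + z + z ^+ 2 <= chord_profile a b z by rewrite le_max lexx.
have H2 z : 1 + (1 + a + b) * z - a * b <= chord_profile a b z.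
  by rewrite le_max lexx orbT.
apply/andP; split.
  apply: le_trans (lerD (ler_wpM2l t0 (H1 x)) (ler_wpM2l t1' (H1 y))).
  have : 0 <= t * (1 - t) * (x - y) ^+ 2 by rewrite mulr_ge0 ?sqr_ge0// mulr_ge0.
  clear; lra.
apply: le_trans (lerD (ler_wpM2l t0 (H2 x)) (ler_wpM2l t1' (H2 y))).
by rewrite le_eqVlt; apply/orP; left; apply/eqP; ring.
Qed.


Lemma hard_cdf_lipschitz (R : realType) (a b x y : R) :
  0 <= a <= 1 -> 0 <= b <= 1 -> x <= y -> y < 1 ->
  hard_cdf a b y <= hard_cdf a b x + 3 * (y - x).
Proof.
move=> a01 b01 xy y1; rewrite /hard_cdf y1 (le_lt_trans xy y1).
set x' := Num.max x 0; set y' := Num.max y 0.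
have x'0 : 0 <= x' by rewrite le_max lexx orbT.
have y'0 : 0 <= y' by rewrite le_max lexx orbT.
have xy' : x' <= y' by rewrite ge_max !le_max xy lexx !orbT.
have y'1 : y' <= 1 by rewrite ge_max (ltW y1) ler01.
have d : y' - x' <= y - x.
  rewrite /y' /x'; case: (leP x 0) => x0; case: (leP y 0) => y0; lra.
have := chord_profile_lipschitz a01 b01 x'0 xy' y'1.
have := chord_profile_ge1 a b x'0; have := chord_profile_ge1 a b y'0.
set u := chord_profile a b x'; set v := chord_profile a b y' => v1 u1 uv.
have [u0 v0] : 0 < u /\ 0 < v by split; lra.
suff : u^-1 - v^-1 <= 3 * (y - x) by lra.
have -> : u^-1 - v^-1 = (v - u) / (u * v) by field; rewrite !gt_eqF.
rewrite ler_pdivrMr ?mulr_gt0//.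
have : 1 * 1 <= u * v by apply: ler_pM.
have : 0 <= y - x by lra.
move=> yx uv1; have : 0 <= (y - x) * (u * v - 1) by rewrite mulr_ge0//; lra.
lra.
Qed.

Lemma hard_cdf_le1 (R : realType) (a b x : R) : hard_cdf a b x <= 1.
Proof.
rewrite /hard_cdf; case: ifP => // _; rewrite gerBl invr_ge0.
by apply: le_trans (chord_profile_ge1 a b (_ : 0 <= Num.max x 0)); rewrite ?ler01// le_max lexx orbT.
Qed.

Lemma hard_cdf_le (R : realType) (a b x y : R) : 0 <= a -> 0 <= b -> x <= y ->
  hard_cdf a b x <= hard_cdf a b y.
Proof.
move=> a0 b0 xy; rewrite [leRHS]/hard_cdf; case: ltP => y1; last exact: hard_cdf_le1.
rewrite /hard_cdf (le_lt_trans xy y1) lerD2l lerN2.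
have x'0 : 0 <= Num.max x 0 by rewrite le_max lexx orbT.
have : Num.max x 0 <= Num.max y 0 by rewrite ge_max !le_max xy lexx !orbT.
rewrite le_eqVlt => /orP[/eqP -> //|xy'].
rewrite lef_pV2 ?posrE; first by rewrite ltW// chord_profile_lt.
  by apply: lt_le_trans (chord_profile_ge1 a b _); rewrite ?le_max ?lexx ?orbT.
by apply: lt_le_trans (chord_profile_ge1 a b _); rewrite ?le_max ?lexx ?orbT.
Qed.

Lemma hard_probability (R : realType) (a b : R) : 0 <= a <= 1 -> 0 <= b <= 1 ->
  exists mu : probability R R, cdf_of mu = hard_cdf a b.
Proof.
move=> a01 b01; have [/andP[a0 a1] /andP[b0 b1]] := (a01, b01).
apply: exists_probability_of_cdf.
- by move=> x y; exact: hard_cdf_le.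
- move=> x; have [x1|x1] := ltP x 1; last first.
    rewrite /hard_cdf ltNge x1 /=; apply: cvg_near_cst; near=> y.
    by rewrite ltNge (le_trans x1)//; near: y; exact: nbhs_right_ge.
  apply/cvgrPdist_le => e e0; near=> y.
  have xy : x <= y by near: y; exact: nbhs_right_ge.
  have y1 : y < 1 by near: y; exact: nbhs_right_lt.
  have ye : y < x + e / 3 by near: y; apply: nbhs_right_lt; rewrite ltrDl divr_gt0.
  have := hard_cdf_lipschitz a01 b01 xy y1; have := hard_cdf_le a0 b0 xy.
  rewrite ler_norml; lra.
- apply: cvg_near_cst; near=> x; have x0 : x <= 0 by near: x; exact: nbhs_ninfty_le.
  rewrite /hard_cdf (le_lt_trans x0)// max_r// chord_profile0// invr1 subrr//.
- apply: cvg_near_cst; near=> x; have x1 : 1 <= x by near: x; exact: nbhs_pinfty_ge.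
  by rewrite /hard_cdf ltNge x1.
Unshelve. all: by end_near. Qed.

Lemma hard_supported (R : realType) (a b : R) (mu : probability R R) :
  0 <= a -> 0 <= b -> cdf_of mu = hard_cdf a b -> supported01 mu.
Proof.
move=> a0 b0 Fmu.
have F1 : cdf_of mu 1 = 1 by rewrite Fmu /hard_cdf ltxx.
have F0 : obs_prob mu false 0 <= 0.
  apply: le_trans (obs_false_le_cdf mu 0) _.
  by rewrite Fmu /hard_cdf ltr01 maxxx chord_profile0// invr1 subrr.
suff H : 1 <= fine (mu [set` `[0, 1]]).
  by apply/eqP; rewrite eq_le probability_le1//= -EFin_fine_prob// lee_fin.
suff : cdf_of mu 1 <= obs_prob mu false 0 + fine (mu [set` `[0, 1]]) by lra.
rewrite -lee_fin EFinD /cdf_of /obs_prob !EFin_fine_prob// -measureU//.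
  apply: le_measure; rewrite ?inE//; first exact: measurableU.
  by move=> x /=; rewrite !in_itv/= => ->; rewrite andbT; case: ltP; [left|right].
apply/seteqP; split => x //=; rewrite !in_itv/= => -[x0 /andP[]].
by rewrite leNgt x0.
Qed.

(** For q > 0 the quantile at 1 - q is the largest v in [0,1] with q g(v) <= 1. In terms of the
    revenue r = q v the constraint reads q g(r/q) <= 1, and the perspective q g(r/q) of the convex
    function g is convex in (q, r). *)
Lemma hard_regular (R : realType) (a b : R) :
  0 <= a <= 1 -> 0 <= b <= 1 -> regular (hard_cdf a b).
Proof.
move=> a01 b01 q1 q2 t q101 q201 t01; have [/andP[a0 a1] /andP[b0 b1]] := (a01, b01).
have [/andP[q10 q11] /andP[q20 q21] /andP[t0 t1]] := And3 q101 q201 t01.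
pose g := chord_profile a b.
have F1 : hard_cdf a b 1 = 1 by rewrite /hard_cdf ltxx.
have Q01 q : 0 <= q -> 0 <= quantile (hard_cdf a b) (1 - q) <= 1.
  move=> q0; have qF : 1 - q <= hard_cdf a b 1 by rewrite F1 gerBl.
  apply/andP; split; first by apply: quantile_ge => // v /andP[].
  by apply: quantile_le; rewrite ?ler01 ?lexx.
(* Points x just below the quantile have F(x) < 1 - q, that is q g(x) < 1; the Lipschitz constant 3
   of g carries this to the quantile itself. *)
have gQ q : 0 <= q <= 1 -> g (quantile (hard_cdf a b) (1 - q)) * q <= 1.
  move=> /andP[q0 qle1]; have /andP[v0 v1] := Q01 q q0.
  set v := quantile _ _ in v0 v1 *.
  have [->|vn0] := eqVneq v 0; first by rewrite /g chord_profile0// mul1r.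
  have vp : 0 < v by rewrite lt_neqAle eq_sym vn0.
  apply/ler_addgt0Pr => e e0.
  pose d := Num.min (v / 2) (e / 3).
  have d0 : 0 < d by rewrite lt_min !divr_gt0.
  have dv : d <= v / 2 by rewrite ge_min lexx.
  have de : d <= e / 3 by rewrite ge_min lexx orbT.
  pose x := v - d; have x0 : 0 <= x by rewrite /x; lra.
  have xv : x < v by rewrite /x; lra.
  have : hard_cdf a b x < 1 - q.
    rewrite ltNge; apply/negP => Fx; have : v <= x.
      by apply: quantile_le => //; apply/andP; split => //; lra.
    lra.
  rewrite /hard_cdf (lt_le_trans xv v1) max_l// ltrD2l ltrN2.
  have gx := chord_profile_ge1 a b x0.
  have gx0 : 0 < chord_profile a b x by lra.
  rewrite -div1r ltr_pdivlMr// => gxq.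
  have L := chord_profile_lipschitz a01 b01 x0 (ltW xv) v1.
  have : (chord_profile a b v - chord_profile a b x - 3 * d) * q <= 0.
    by rewrite mulr_le0_ge0//; move: L; rewrite /x; lra.
  have : d * q <= d * 1 by apply: ler_wpM2l => //; exact: ltW.
  rewrite /g; move: gxq de; clear; nra.
rewrite /revenue; set v1 := quantile _ (1 - q1); set v2 := quantile _ (1 - q2).
set q := t * q1 + (1 - t) * q2.
have t1' : 0 <= 1 - t by lra.
have q0 : 0 <= q by rewrite addr_ge0 ?mulr_ge0.
have [qz|qn0] := eqVneq q 0.
  have [A0 B0] : 0 <= t * q1 /\ 0 <= (1 - t) * q2 by rewrite !mulr_ge0.
  have tq1 : t * q1 = 0 by move: qz A0 B0; rewrite /q; lra.
  have tq2 : (1 - t) * q2 = 0 by move: qz A0 B0; rewrite /q; lra.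
  by rewrite qz !mulrA tq1 tq2 !mul0r addr0.
have qp : 0 < q by rewrite lt_neqAle eq_sym qn0.
have q1' : q <= 1 by rewrite /q; nra.
have /andP[v10 v11] := Q01 q1 q10; have /andP[v20 v21] := Q01 q2 q20.
rewrite -/v1 in v10 v11; rewrite -/v2 in v20 v21.
have gv1 := gQ q1 q101; have gv2 := gQ q2 q201; rewrite -/v1 in gv1; rewrite -/v2 in gv2.
(* Perspective weights: l q = t q1 and (1-l) q = (1-t) q2. *)
pose l := t * q1 / q.
have l01 : 0 <= l <= 1.
  rewrite /l divr_ge0 ?mulr_ge0//= ler_pdivrMr// mul1r /q lerDl mulr_ge0//.
have lq : l * q = t * q1 by rewrite /l divfK.
have lq' : (1 - l) * q = (1 - t) * q2 by rewrite mulrBl lq mul1r /q addrC addKr.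
pose m := l * v1 + (1 - l) * v2.
have -> : t * (q1 * v1) + (1 - t) * (q2 * v2) = q * m.
  transitivity (l * q * v1 + (1 - l) * q * v2); first by rewrite lq lq' !mulrA.
  rewrite /m; move: (l) (q) => x y; ring.
rewrite ler_pM2l//.
have /andP[l0 l1] := l01; have l1' : 0 <= 1 - l by lra.
have m0 : 0 <= m by apply: addr_ge0; exact: mulr_ge0.
have m1 : m <= 1.
  have : l * v1 <= l * 1 by rewrite ler_wpM2l.
  have : (1 - l) * v2 <= (1 - l) * 1 by rewrite ler_wpM2l.
  rewrite /m; lra.
have gm : g m * q <= 1.
  have C := chord_profile_convex a b v1 v2 l01.
  have : g m * q <= (l * g v1 + (1 - l) * g v2) * q by rewrite ler_pM2r.
  have -> : (l * g v1 + (1 - l) * g v2) * q = t * (g v1 * q1) + (1 - t) * (g v2 * q2).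
    transitivity (l * q * g v1 + (1 - l) * q * g v2).
      by move: (g v1) (g v2) (l) (q) => ? ? ? ?; ring.
    by rewrite lq lq'; move: (g v1) (g v2) => ? ?; ring.
  have : t * (g v1 * q1) <= t * 1 by rewrite ler_wpM2l.
  have : (1 - t) * (g v2 * q2) <= (1 - t) * 1 by rewrite ler_wpM2l.
  lra.
apply: quantile_ge => [|x /andP[x0 x1] Fx]; first by rewrite F1 gerBl.
rewrite leNgt; apply/negP => xm.
have xl1 : x < 1 by exact: lt_le_trans m1.
move: Fx; rewrite /hard_cdf xl1 max_l// lerD2l lerN2.
have gx := chord_profile_ge1 a b x0.
have gx0 : 0 < chord_profile a b x by lra.
rewrite -div1r ler_pdivrMr//.
have : g x * q < g m * q by rewrite ltr_pM2r// chord_profile_lt.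
by rewrite /g; move: gm; rewrite /g mulrC (mulrC _ q) => ? ? ?; lra.
Qed.

Lemma hard_obs_false (R : realType) (a b : R) (mu : probability R R) p :
  0 <= a <= 1 -> 0 <= b <= 1 -> cdf_of mu = hard_cdf a b -> p < 1 ->
  obs_prob mu false p = hard_cdf a b p.
Proof.
move=> a01 b01 Fmu p1; apply/eqP; rewrite eq_le -Fmu obs_false_le_cdf /=.
apply/ler_addgt0Pr => e e0.
have pe : p - e / 3 < p by rewrite ltrBlDr ltrDl divr_gt0.
have := cdf_le_obs_false mu pe; have := hard_cdf_lipschitz a01 b01 (ltW pe) p1.
rewrite Fmu; lra.
Qed.

Lemma chord_profile_out (R : realType) (a b v : R) : a <= b -> v <= a \/ b <= v ->
  chord_profile a b v = chord_profile (1 / 2) (1 / 2) v.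
Proof.
move=> ab vab; rewrite !chord_profileE !max_l//; last by case: vab => ?; nra.
have : 0 <= (v - 1 / 2) ^+ 2 by exact: sqr_ge0.
nra.
Qed.

Lemma hard_obs_out (R : realType) (a b : R) (mu mu0 : probability R R) c p :
  1 / 2 <= a -> a <= b -> b <= 3 / 4 -> cdf_of mu = hard_cdf a b ->
  cdf_of mu0 = hard_cdf (1 / 2) (1 / 2) -> p <= a \/ b <= p ->
  obs_prob mu c p = obs_prob mu0 c p.
Proof.
move=> a2 ab b4 Fmu Fmu0 pab.
have [a01 b01 h01] : [/\ 0 <= a <= 1, 0 <= b <= 1 & 0 <= (1 / 2 : R) <= 1].
  by split; apply/andP; split; lra.
suff E : obs_prob mu false p = obs_prob mu0 false p.
  by case: c => //; have := obs_prob_sum mu p; have := obs_prob_sum mu0 p; lra.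
have Eout x : x <= a \/ b <= x -> hard_cdf a b x = hard_cdf (1 / 2) (1 / 2) x.
  move=> xab; rewrite /hard_cdf; case: ifP => // _; rewrite chord_profile_out//.
  by case: xab => H; [left; rewrite ge_max H; lra|right; rewrite le_max H].
have [p1|p1] := ltP p 1.
  by rewrite (hard_obs_false a01 b01 Fmu p1) (hard_obs_false h01 h01 Fmu0 p1) Eout.
(* For p >= 1 the jump at 1 interferes with the Lipschitz argument; P(V < p) is then bounded through
   the values of the CDF on [3/4, p[, where the two distributions agree. *)
have half (nu nu' : probability R R) : (forall x, 3 / 4 <= x -> cdf_of nu x = cdf_of nu' x) ->
    obs_prob nu false p <= obs_prob nu' false p.
  move=> EE; apply: obs_false_le => x xp.
  apply: (@le_trans _ _ (cdf_of nu (Num.max x (3 / 4)))).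
    by apply: cdf_of_le; rewrite le_max lexx.
  rewrite EE ?le_max ?lexx ?orbT//; apply: cdf_le_obs_false.
  by rewrite gt_max xp; lra.
apply/eqP; rewrite eq_le; apply/andP; split; apply: half => x x4;
  rewrite Fmu Fmu0 Eout//; right; lra.
Qed.

(** With u = 1 + p + p^2 and D = (p-a)(b-p), both u and u + D lie in [7/4, 3], and the difference of
    the CDFs is D/(u (u+D)), between D/9 and D. *)
Lemma hard_cdf_window (R : realType) (a b p : R) : 1 / 2 <= a -> b <= 3 / 4 -> a < p < b ->
  [/\ 3 / 7 <= hard_cdf a b p <= 2 / 3, 3 / 7 <= hard_cdf (1 / 2) (1 / 2) p <= 2 / 3 &
  [/\ hard_cdf (1 / 2) (1 / 2) p <= hard_cdf a b p,
      hard_cdf a b p - hard_cdf (1 / 2) (1 / 2) p <= (p - a) * (b - p) &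
      (p - a) * (b - p) / 9 <= hard_cdf a b p - hard_cdf (1 / 2) (1 / 2) p]].
Proof.
move=> a2 b4 /andP[ap pb].
have p1 : p < 1 by lra.
rewrite /hard_cdf p1 max_l; last lra.
have E0 : chord_profile (1 / 2) (1 / 2) p = 1 + p + p ^+ 2.
  rewrite chord_profileE max_l ?addr0//.
  by have := sqr_ge0 (p - 1 / 2); lra.
have D0 : 0 < (p - a) * (b - p) by rewrite mulr_gt0; lra.
have E1 : chord_profile a b p = 1 + p + p ^+ 2 + (p - a) * (b - p).
  by rewrite chord_profileE max_r// ltW.
have D1 : (p - a) * (b - p) <= 1 / 4 * (1 / 4) by rewrite ler_pM; lra.
have P2 : p ^+ 2 <= 3 / 4 * (3 / 4) by rewrite expr2 ler_pM; lra.
have P1 : 1 / 2 * (1 / 2) <= p ^+ 2 by rewrite expr2 ler_pM; lra.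
rewrite E0 E1; set D := _ * _ in D0 D1 *; set u := 1 + p + p ^+ 2.
have u1 : 7 / 4 <= u by rewrite /u; lra.
have u3 : u + D <= 3 by rewrite /u; lra.
have iu : (3 : R)^-1 <= u^-1 <= (7 / 4)^-1.
  by rewrite !lef_pV2 ?posrE; lra.
have iv : (3 : R)^-1 <= (u + D)^-1 <= (7 / 4)^-1.
  by rewrite !lef_pV2 ?posrE; lra.
have E74 : (7 / 4 : R)^-1 = 4 / 7 by field.
have E3 : (3 : R)^-1 = 1 / 3 by field.
rewrite E74 E3 in iu iv; have [/andP[iu1 iu2] /andP[iv1 iv2]] := (iu, iv).
have dE : 1 - (u + D)^-1 - (1 - u^-1) = D * (u^-1 * (u + D)^-1).
  by field; rewrite !gt_eqF//; lra.
have [iu0 iv0] : 0 <= u^-1 /\ 0 <= (u + D)^-1 by split; lra.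
have [iu11 iv11] : u^-1 <= 1 /\ (u + D)^-1 <= 1 by split; lra.
have pr1 : u^-1 * (u + D)^-1 <= 1 * 1 by apply: ler_pM.
have pr2 : 1 / 3 * (1 / 3) <= u^-1 * (u + D)^-1 by apply: ler_pM => //; rewrite divr_ge0.
have h1 : D * (u^-1 * (u + D)^-1) <= D * (1 * 1) by rewrite ler_pM2l.
have h2 : D * (1 / 3 * (1 / 3)) <= D * (u^-1 * (u + D)^-1) by rewrite ler_pM2l.
rewrite dE; move: iu1 iu2 iv1 iv2 h1 h2 D0 dE; clear => *.
by split; [| |split]; lra.
Qed.

(** * The lower bound: testing two distributions adaptively *)

Lemma expect_ge0 (R : realType) (mu : probability R R) price n (f : seq bool -> R) h :
  (forall x, 0 <= f x) -> 0 <= expect mu price n f h.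
Proof.
by move=> f0; rewrite -(expect_cst mu price n 0 h); apply: expect_le => x _; exact: f0.
Qed.

(* Hellinger affinity of the laws of the next n observations under mu and nu. *)
Fixpoint affinity (R : realType) (mu nu : probability R R) (price : seq bool -> R)
    (n : nat) (h : seq bool) : R :=
  if n is n'.+1 then
    Num.sqrt (obs_prob mu true (price h) * obs_prob nu true (price h))
      * affinity mu nu price n' (rcons h true) +
    Num.sqrt (obs_prob mu false (price h) * obs_prob nu false (price h))
      * affinity mu nu price n' (rcons h false)
  else 1.

Fixpoint expected_hits (R : realType) (mu : probability R R) (price : seq bool -> R)
    (W : pred R) (n : nat) (h : seq bool) : R :=
  if n is n'.+1 then
    (W (price h))%:R + (obs_prob mu true (price h) * expected_hits mu price W n' (rcons h true)
      + obs_prob mu false (price h) * expected_hits mu price W n' (rcons h false))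
  else 0.

(** Le Cam's bound via Hellinger affinity. Without queries the left side is at most max(u,v) =
    (u+v)/2 + |x-y|(x+y)/2 for x = sqrt u, y = sqrt v, and the product is split by a weighted
    arithmetic-geometric inequality with parameter s. This keeps the bound linear in the affinity.
    The weights u and v carry the likelihoods of the history through the induction. *)
Lemma disjoint_tests_weighted (R : realType) (mu nu : probability R R) price n
    (f f' : seq bool -> R) h (u v s : R) :
  0 < s -> 0 <= u -> 0 <= v -> (forall x, 0 <= f x) -> (forall x, 0 <= f' x) ->
  (forall x, f x + f' x <= 1) ->
  u * expect mu price n f h + v * expect nu price n f' h <=
    (u + v) * (1 / 2 + s / 2 + 1 / (4 * s))
      - Num.sqrt (u * v) * affinity mu nu price n h / (2 * s).
Proof.
move=> s0 + + f0 f'0 ff'; elim: n h u v => [|n IH] h u v u0 v0 /=.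
  set x := Num.sqrt u; set y := Num.sqrt v.
  have xy : Num.sqrt (u * v) = x * y by rewrite sqrtrM.
  have ux : u = x ^+ 2 by rewrite sqr_sqrtr.
  have vy : v = y ^+ 2 by rewrite sqr_sqrtr.
  have [x0 y0] : 0 <= x /\ 0 <= y by split; exact: sqrtr_ge0.
  rewrite xy mulr1.
  have L : u * f h + v * f' h <= Num.max u v.
    have A : u * f h <= Num.max u v * f h by rewrite ler_wpM2r// le_max lexx.
    have B : v * f' h <= Num.max u v * f' h by rewrite ler_wpM2r// le_max lexx orbT.
    apply: le_trans (lerD A B) _; rewrite -mulrDr -[leRHS]mulr1 ler_wpM2l//.
    by rewrite le_max u0.
  apply: le_trans L _; rewrite -(ler_pM2r (_ : 0 < 4 * s)); last by rewrite mulr_gt0.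
  have -> : ((u + v) * (1 / 2 + s / 2 + 1 / (4 * s)) - x * y / (2 * s)) * (4 * s)
    = 2 * s * (u + v) + 2 * s ^+ 2 * (u + v) + (u + v) - 2 * (x * y).
    by field; rewrite gt_eqF.
  rewrite ux vy.
  have P : forall z z' : R, 0 <= z -> 0 <= z' ->
      z ^+ 2 * (4 * s) <= 2 * s * (z ^+ 2 + z' ^+ 2) + 2 * s ^+ 2 * (z ^+ 2 + z' ^+ 2)
        + (z ^+ 2 + z' ^+ 2) - 2 * (z * z').
    move=> z z' z0 z'0.
    have := sqr_ge0 (z - z' - s * (z + z')); have := sqr_ge0 (s * (z - z')).
    clear; lra.
  by rewrite maxEle; case: ifP => _; [have := P y x y0 x0|have := P x y x0 y0]; lra.
set p := obs_prob mu _ _; set p' := obs_prob mu _ _.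
set q := obs_prob nu _ _; set q' := obs_prob nu _ _.
have [p0 p'0 q0 q'0] : [/\ 0 <= p, 0 <= p', 0 <= q & 0 <= q'].
  by split; exact: obs_prob_ge0.
have pp : p + p' = 1 by exact: obs_prob_sum.
have qq : q + q' = 1 by exact: obs_prob_sum.
have A := IH (rcons h true) (u * p) (v * q) (mulr_ge0 u0 p0) (mulr_ge0 v0 q0).
have B := IH (rcons h false) (u * p') (v * q') (mulr_ge0 u0 p'0) (mulr_ge0 v0 q'0).
rewrite mulrACA sqrtrM in A; last exact: mulr_ge0.
rewrite mulrACA sqrtrM in B; last exact: mulr_ge0.
set k := 1 / 2 + s / 2 + 1 / (4 * s) in A B *.
have -> : (u + v) * k = (u * p + v * q) * k + (u * p' + v * q') * k.
  have -> : (u * p + v * q) * k + (u * p' + v * q') * k = (u * (p + p') + v * (q + q')) * k.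
    by move: (k) => z; ring.
  by rewrite pp qq !mulr1.
move: A B; clear; move: (Num.sqrt (u * v)) (Num.sqrt (p * q)) (Num.sqrt (p' * q')).
move: (expect _ _ _ _ _) (expect _ _ _ _ _) (expect _ _ _ _ _) (expect _ _ _ _ _).
move: (affinity _ _ _ _ _) (affinity _ _ _ _ _) (2 * s)^-1 k => *; lra.
Qed.

(** The affinity is the mean under [mu] of the product of the ratios r = sqrt(nu/mu), and x >= 1 +
    ln x plays the role of Jensen's inequality. A query in [W] costs at most X/2, as ln r >= (1 -
    mu/nu)/2 and [X] bounds the chi-square divergence of one answer; the other queries have r = 1.
    The weight w is the product accumulated so far. *)
Lemma affinity_ge (R : realType) (mu nu : probability R R) price (W : pred R) (X : R) n h w :
  (forall c p, ~~ W p -> obs_prob nu c p = obs_prob mu c p) ->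
  (forall c p, W p -> 0 < obs_prob mu c p /\ 0 < obs_prob nu c p) ->
  (forall p, W p -> \sum_c obs_prob mu c p * (obs_prob mu c p / obs_prob nu c p - 1) <= X) ->
  0 < w ->
  1 + ln w - X / 2 * expected_hits mu price W n h <= w * affinity mu nu price n h.
Proof.
move=> out pos chi; elim: n h w => [|n IH] h w w0 /=.
  by rewrite mulr0 subr0 mulr1; have := ln_le_subr1 w0; lra.
pose r c := if W (price h) then Num.sqrt (obs_prob nu c (price h) / obs_prob mu c (price h))
  else 1.
have r0 c : 0 < r c.
  rewrite /r; case: ifP => // /(pos c)[p0 q0]; by rewrite sqrtr_gt0 divr_gt0.
have rE c : Num.sqrt (obs_prob mu c (price h) * obs_prob nu c (price h))
    = obs_prob mu c (price h) * r c.
  rewrite /r; case: ifPn => [/(pos c)[p0 q0]|/out ->]; last first.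
    by rewrite -expr2 sqrtr_sqr ger0_norm ?obs_prob_ge0// mulr1.
  set p := obs_prob mu _ _ in p0 *; set q := obs_prob nu _ _ in q0 *.
  have -> : p * q = p ^+ 2 * (q / p) by field; rewrite gt_eqF.
  by rewrite sqrtrM ?sqr_ge0// sqrtr_sqr ger0_norm// ltW.
have lnr : - (X / 2) * (W (price h))%:R <=
    obs_prob mu true (price h) * ln (r true) + obs_prob mu false (price h) * ln (r false).
  rewrite /r; case: ifPn => [Wp|_]; last by rewrite ln1 !mulr0 addr0.
  have H c : (1 - obs_prob mu c (price h) / obs_prob nu c (price h)) / 2 <=
      ln (Num.sqrt (obs_prob nu c (price h) / obs_prob mu c (price h))).
    have [p0 q0] := pos c _ Wp.
    set x := Num.sqrt _; have x0 : 0 < x by rewrite sqrtr_gt0 divr_gt0.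
    have xx : x ^+ 2 = obs_prob nu c (price h) / obs_prob mu c (price h).
      by rewrite sqr_sqrtr// divr_ge0// ltW.
    have := @ln_ge_1BV R (x ^+ 2) (exprn_gt0 _ x0).
    rewrite lnXn// xx invf_div -[ln x *+ 2]mulr_natl; lra.
  have := chi _ Wp; rewrite big_bool /= => C.
  have T := ler_wpM2l (obs_prob_ge0 mu true (price h)) (H true).
  have F := ler_wpM2l (obs_prob_ge0 mu false (price h)) (H false).
  rewrite mulr1; apply: le_trans (lerD T F); move: C; clear; lra.
have step c : obs_prob mu c (price h) *
    (1 + ln w + ln (r c) - X / 2 * expected_hits mu price W n (rcons h c)) <=
    w * (obs_prob mu c (price h) * r c * affinity mu nu price n (rcons h c)).
  rewrite (_ : w * _ = obs_prob mu c (price h) * (w * r c * affinity mu nu price n (rcons h c))).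
    rewrite ler_wpM2l ?obs_prob_ge0//.
    by have := IH (rcons h c) (w * r c) (mulr_gt0 w0 (r0 c)); rewrite lnM ?posrE//; lra.
  by ring.
rewrite !rE [leRHS]mulrDr; apply: le_trans (lerD (step true) (step false)).
have S := obs_prob_sum mu (price h).
rewrite -[X in X - _ <= _]mul1r -{1}S.
move: lnr; clear; lra.
Qed.

Lemma sum_expected_hits (R : realType) (mu : probability R R) price (J : nat)
    (W : nat -> pred R) n h :
  (forall p, \sum_(j < J) (W j p)%:R <= 1 :> R) ->
  \sum_(j < J) expected_hits mu price (W j) n h <= n%:R.
Proof.
move=> W1; elim: n h => [|n IH] h /=; first by rewrite big1.
rewrite !big_split /= -!mulr_sumr -natr1 addrC lerD//.
have T := ler_wpM2l (obs_prob_ge0 mu true (price h)) (IH (rcons h true)).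
have F := ler_wpM2l (obs_prob_ge0 mu false (price h)) (IH (rcons h false)).
by apply: le_trans (lerD T F) _; rewrite -mulrDl obs_prob_sum mul1r.
Qed.

Lemma disjoint_tests (R : realType) (mu nu : probability R R) price (W : pred R) (X s : R)
    n (f f' : seq bool -> R) :
  0 < s -> (forall x, 0 <= f x) -> (forall x, 0 <= f' x) -> (forall x, f x + f' x <= 1) ->
  (forall c p, ~~ W p -> obs_prob nu c p = obs_prob mu c p) ->
  (forall c p, W p -> 0 < obs_prob mu c p /\ 0 < obs_prob nu c p) ->
  (forall p, W p -> \sum_c obs_prob mu c p * (obs_prob mu c p / obs_prob nu c p - 1) <= X) ->
  expect mu price n f [::] + expect nu price n f' [::]
    <= 1 + s + X / (4 * s) * expected_hits mu price W n [::].
Proof.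
move=> s0 f0 f'0 ff' out pos chi.
have A := @disjoint_tests_weighted R mu nu price n f f' [::] 1 1 s s0 ler01 ler01 f0 f'0 ff'.
have B := @affinity_ge R mu nu price W X n [::] 1 out pos chi ltr01.
rewrite !mul1r sqrtr1 mul1r in A; rewrite ln1 mul1r addr0 in B.
have C : (1 - X / 2 * expected_hits mu price W n [::]) / (2 * s)
    <= affinity mu nu price n [::] / (2 * s) by rewrite ler_pM2r// invr_gt0 mulr_gt0.
apply: le_trans A _.
apply: (@le_trans _ _ ((1 + 1) * (2^-1 + s / 2 + (4 * s)^-1)
  - (1 - X / 2 * expected_hits mu price W n [::]) / (2 * s))); first by rewrite lerD2l lerN2.
by rewrite le_eqVlt; apply/orP; left; apply/eqP; field; rewrite gt_eqF.
Qed.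

(** * Separation and chi-square distance of the hard distributions *)

Lemma levy_witness (R : realType) (F G : R -> R) (e d : R) :
  {homo F : x y / x <= y} -> e < d -> (levy F G <= e%:E)%E ->
  forall v, F (v - d) - d <= G v /\ G v <= F (v + d) + d.
Proof.
(* The infimum need not be attained at e; a witness below d exists, and monotonicity of F enlarges
   it to d. *)
move=> Fnd ed FG v; have : (levy F G < d%:E)%E by apply: le_lt_trans FG _; rewrite lte_fin.
move=> /ereal_inf_lt[_ [z Hz <-]]; rewrite lte_fin => zd.
have [H1 H2] := Hz v; have := Fnd (v - d) (v - z); have := Fnd (v + z) (v + d).
rewrite !lerD2l lerN2 (ltW zd) => /(_ isT) ? /(_ isT) ?; split; lra.
Qed.

(** At the middle of the window the two CDFs differ by at least (b-a)^2/36. A common approximation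
    G, used with tolerance 2e and Lipschitz constant 3, would force the difference to be at most 2
    (6e + 2e) = 16e, while 36 times 16 is 576 = 144 times 4. *)
Lemma hard_separated (R : realType) (a b e : R) (mu mu0 : probability R R) (G : R -> R) :
  1 / 2 <= a -> b <= 3 / 4 -> a < b -> 0 < e -> e <= 1 / 40 ->
  144 * (4 * e) < (b - a) ^+ 2 -> cdf_of mu = hard_cdf a b ->
  cdf_of mu0 = hard_cdf (1 / 2) (1 / 2) ->
  ~ ((levy (cdf_of mu) G <= e%:E)%E /\ (levy (cdf_of mu0) G <= e%:E)%E).
Proof.
move=> a2 b4 ab e0 e40 big Fmu Fmu0 [L L0].
have e2 : e < 2 * e by lra.
have [a01 b01 h01] : [/\ 0 <= a <= 1, 0 <= b <= 1 & 0 <= (1 / 2 : R) <= 1].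
  by split; apply/andP; split; lra.
pose m := (a + b) / 2.
have [H _] := levy_witness (cdf_of_le mu) e2 L m.
have [_ H0] := levy_witness (cdf_of_le mu0) e2 L0 m.
rewrite Fmu in H; rewrite Fmu0 in H0.
have m01 : a < m < b by apply/andP; split; rewrite /m; lra.
have [_ _ [_ _ D]] := hard_cdf_window a2 b4 m01.
have E : (m - a) * (b - m) = (b - a) ^+ 2 / 4 by rewrite /m; field.
rewrite E in D; move: m01 => /andP[am mb].
have := @hard_cdf_lipschitz R a b (m - 2 * e) m a01 b01.
have := @hard_cdf_lipschitz R (1 / 2) (1 / 2) m (m + 2 * e) h01 h01.
have -> : m + 2 * e - m = 2 * e by ring.
have -> : m - (m - 2 * e) = 2 * e by ring.
have h1 : m <= m + 2 * e by lra.
have h2 : m + 2 * e < 1 by lra.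
have h3 : m - 2 * e <= m by lra.
have h4 : m < 1 by lra.
move=> /(_ h1 h2) ? /(_ h3 h4) ?; lra.
Qed.

Lemma hard_chi2 (R : realType) (a b : R) (mu mu0 : probability R R) p :
  1 / 2 <= a -> b <= 3 / 4 -> a < p < b -> cdf_of mu = hard_cdf a b ->
  cdf_of mu0 = hard_cdf (1 / 2) (1 / 2) ->
  (forall c, 0 < obs_prob mu0 c p /\ 0 < obs_prob mu c p) /\
  \sum_c obs_prob mu0 c p * (obs_prob mu0 c p / obs_prob mu c p - 1) <= (b - a) ^+ 4 / 2.
Proof.
move=> a2 b4 pab Fmu Fmu0; have /andP[ap pb] := pab.
have [a01 b01 h01] : [/\ 0 <= a <= 1, 0 <= b <= 1 & 0 <= (1 / 2 : R) <= 1].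
  by split; apply/andP; split; lra.
have p1 : p < 1 by lra.
have Ef := hard_obs_false a01 b01 Fmu p1; have Ef0 := hard_obs_false h01 h01 Fmu0 p1.
have [B B0 [D0 D1 _]] := hard_cdf_window a2 b4 pab.
rewrite -Ef in B D0 D1; rewrite -Ef0 in B0 D0 D1.
have S := obs_prob_sum mu p; have S0 := obs_prob_sum mu0 p.
have Et : obs_prob mu true p = 1 - obs_prob mu false p by lra.
have Et0 : obs_prob mu0 true p = 1 - obs_prob mu0 false p by lra.
rewrite big_bool /= Et Et0.
set f := obs_prob mu false p in B D0 D1 Et *.
set f0 := obs_prob mu0 false p in B0 D0 D1 Et0 *.
move: B B0 => /andP[fl fu] /andP[f0l f0u].
split; first by case; rewrite ?Et ?Et0; split; lra.
have fn0 : 0 < f by lra.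
have fn1 : 0 < 1 - f by lra.
have -> : (1 - f0) * ((1 - f0) / (1 - f) - 1) + f0 * (f0 / f - 1) =
    (f - f0) ^+ 2 / (f * (1 - f)) by field; rewrite !gt_eqF.
have dq : (p - a) * (b - p) <= (b - a) ^+ 2 / 4.
  by have := sqr_ge0 (p - a - (b - p)); clear; lra.
have d0 : 0 <= f - f0 by lra.
have dd : (f - f0) ^+ 2 <= ((b - a) ^+ 2 / 4) ^+ 2.
  by rewrite lerXn2r ?nnegrE//; [rewrite divr_ge0 ?sqr_ge0|lra].
(* The variance f(1-f) is at least 1/7, so the divergence is at most 7 (b-a)^4/16. *)
have ff : 3 / 7 * (1 / 3) <= f * (1 - f) by apply: ler_pM; lra.
rewrite ler_pdivrMr ?mulr_gt0//; apply: le_trans dd _.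
have q0 : 0 <= (b - a) ^+ 4 by rewrite exprn_even_ge0.
have : 0 <= (b - a) ^+ 4 * (f * (1 - f) - 3 / 7 * (1 / 3)) by rewrite mulr_ge0// subr_ge0.
move: q0; clear; lra.
Qed.

(** * Averaging over the windows *)

Definition window (R : realType) (w : R) (j : nat) : pred R :=
  fun p => 1 / 2 + j%:R * w < p < 1 / 2 + j.+1%:R * w.

Lemma windows_disjoint (R : realType) (w p : R) (J : nat) : 0 < w ->
  \sum_(j < J) (window w j p)%:R <= 1 :> R.
Proof.
move=> w0; have [[j0 H0]|none] := pselect (exists j : 'I_J, window w j p).
  rewrite (bigD1 j0)// H0 big1 => [|j /andP[_ jj0]]; first by rewrite /= addr0.
  have [Hj|_ //] := boolP (window w j p).
  case/andP: Hj => H1 H2; case/andP: H0 => H3 H4.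
  have lt (i k : nat) : 1 / 2 + i%:R * w < p -> p < 1 / 2 + k.+1%:R * w -> (i <= k)%N.
    by move=> /lt_trans/[apply]; rewrite ltrD2l ltr_pM2r// ltr_nat ltnS.
  case/eqP: jj0; apply: val_inj; apply/eqP.
  by rewrite eqn_leq (lt _ _ H1 H4) (lt _ _ H3 H2).
rewrite big1// => j _; have [Hj|_ //] := boolP (window w j p).
by case: none; exists j.
Qed.

Lemma det_success_ge0 (R : realType) n price out (mu : probability R R) e :
  0 <= det_success n price out mu e.
Proof. by rewrite det_success_expect; apply: expect_ge0 => x; rewrite ler0n. Qed.

Lemma windows_det_success (R : realType) (e w : R) (J n : nat) price out
    (mu0 : probability R R) (mu : nat -> probability R R) :
  0 < e -> e <= 1 / 40 -> 0 < w -> 144 * (4 * e) < w ^+ 2 -> J%:R * w <= 1 / 4 ->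
  cdf_of mu0 = hard_cdf (1 / 2) (1 / 2) ->
  (forall j, (j < J)%N ->
     cdf_of (mu j) = hard_cdf (1 / 2 + j%:R * w) (1 / 2 + j.+1%:R * w)) ->
  \sum_(j < J) (det_success n price out mu0 e + det_success n price out (mu j) e)
    <= J%:R * (1 + 1 / 6) + 3 / 4 * w ^+ 4 * n%:R.
Proof.
move=> e0 e40 w0 we Jw F0 F.
apply: (@le_trans _ _ (\sum_(j < J)
  (1 + 1 / 6 + 3 / 4 * w ^+ 4 * expected_hits mu0 price (window w j) n [::]))); last first.
  rewrite big_split /= sumr_const card_ord -[_ *+ J]mulr_natl lerD2l -mulr_sumr.
  rewrite ler_wpM2l ?sum_expected_hits ?mulr_ge0 ?exprn_ge0 ?ltW// => p.
  exact: windows_disjoint.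
apply: ler_sum => j _.
have ba : 1 / 2 + j.+1%:R * w - (1 / 2 + j%:R * w) = w by rewrite -natr1; ring.
have a2 : 1 / 2 <= 1 / 2 + j%:R * w by rewrite lerDl mulr_ge0// ltW.
have b4 : 1 / 2 + j.+1%:R * w <= 3 / 4.
  have : j.+1%:R * w <= J%:R * w by rewrite ler_pM2r// ler_nat.
  lra.
have ab : 1 / 2 + j%:R * w < 1 / 2 + j.+1%:R * w by rewrite -subr_gt0 ba.
have Fj := F j (ltn_ord j).
(* The free parameter is s = 1/6: then 1 + s stays below the 4/3 that two success probabilities of
   2/3 would add up to. *)
have XE : 3 / 4 * w ^+ 4 = w ^+ 4 / 2 / (4 * (1 / 6)) by field.
rewrite !det_success_expect XE; apply: disjoint_tests => //.
- move=> x; have := @hard_separated R _ _ e (mu j) mu0 (out x) a2 b4 ab e0 e40.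
  rewrite ba => /(_ we Fj F0); do 2 case: (levy _ _ <= _)%E => //=; rewrite ?addr0 ?add0r//.
  by case; split.
- move=> c p; rewrite /window negb_and -!leNgt => /orP pab.
  exact: (hard_obs_out c a2 (ltW ab) b4 Fj F0 pab).
- by move=> c p pW; have [+ _] := hard_chi2 a2 b4 pW Fj F0; apply.
- by move=> p pW; have [_] := hard_chi2 a2 b4 pW Fj F0; rewrite ba.
Qed.

(** The bound on the sum holds for every outcome of the internal randomness, so it survives
    integration, whereas the least visited window changes with the outcome. *)
Lemma success_sum_le (R : realType) d (Omega : measurableType d) (P : probability Omega R)
    (n J : nat) price out (mu0 : probability R R) (mu : nat -> probability R R) (e B : R) :
  measurable_alg n price out ->
  (forall w, \sum_(j < J) (det_success n (price w) (out w) mu0 e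
     + det_success n (price w) (out w) (mu j) e) <= B) ->
  (\sum_(j < J) (success P n price out mu0 e + success P n price out (mu j) e) <= B%:E)%E.
Proof.
move=> malg HB.
have d0 nu w : (0 <= (det_success n (price w) (out w) nu e)%:E)%E.
  by rewrite lee_fin det_success_ge0.
rewrite /success.
under eq_bigr do rewrite -ge0_integralD//.
rewrite -ge0_integral_sum//; last 2 first.
- by move=> j; apply: emeasurable_funD; exact: malg.
- by move=> j w _; rewrite adde_ge0.
apply: (@le_trans _ _ (\int[P]_w (cst B%:E) w)%E).
  apply: ge0_le_integral => //.
  - by move=> w _; apply: sume_ge0 => j _; rewrite adde_ge0.
  - by apply: emeasurable_sum => j; apply: emeasurable_funD; exact: malg.
  - move=> w _; under eq_bigr do rewrite -EFinD.
    by rewrite sumEFin lee_fin.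
rewrite integral_cst// -[leRHS]mule1; rewrite le_eqVlt; apply/orP; left; apply/eqP; congr (_ * _)%E.
exact: probability_setT.
Qed.

Lemma pricing_query_lower_bound (R : realType) :
  exists (c eps0 : R), 0 < c /\ 0 < eps0 /\
    forall eps : R, 0 < eps < eps0 ->
      forall n : nat, n%:R <= c * (Num.sqrt eps ^+ 5)^-1 ->
      forall (d : measure_display) (Omega : measurableType d)
             (P : probability Omega R)
             (price : Omega -> seq bool -> R) (out : Omega -> seq bool -> R -> R),
        measurable_alg n price out ->
        exists mu : probability R R, supported01 mu /\ regular (cdf_of mu) /\
          (success P n price out mu eps < (2 / 3)%:E)%E.
Proof.
exists ((72 * 25 ^+ 5)^-1), ((200 ^+ 2)^-1).
split; first by rewrite invr_gt0 mulr_gt0 ?exprn_gt0 ?ltr0n.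
split; first by rewrite invr_gt0 exprn_gt0 ?ltr0n.
move=> e /andP[e0 e1] n nle d Omega P price out malg.
set x := Num.sqrt e in nle; have x0 : 0 < x by rewrite sqrtr_gt0.
have xx : x ^+ 2 = e by rewrite sqr_sqrtr// ltW.
have x1 : x < 200^-1.
  rewrite -(@ltr_pXn2r _ 2)// ?nnegrE ?invr_ge0 ?ler0n ?(ltW x0)//.
  by rewrite xx exprVn.
(* 25 is the first integer whose square exceeds 576, the separation constant. The threshold on eps
   gives w <= 1/8, so that the J windows fill at least half of [1/2, 3/4]. *)
pose w := 25 * x; have w0 : 0 < w by rewrite mulr_gt0 ?ltr0n.
have w8 : w <= 1 / 8.
  have -> : 1 / 8 = 25 * 200^-1 :> R by field.
  by rewrite ler_pM2l ?ltr0n// ltW.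
have we : 144 * (4 * e) < w ^+ 2 by rewrite /w exprMn xx; move: e0; clear; lra.
have e40 : e <= 1 / 40.
  have : w * w <= 1 / 8 * (1 / 8) by rewrite ler_pM// ltW.
  by move: we e0; rewrite expr2; clear; lra.
pose J := Num.truncn (4 * w)^-1.
have w4 : 0 < (4 * w)^-1 by rewrite invr_gt0 mulr_gt0.
have /andP[J1 J2] := Num.Theory.truncn_itv (ltW w4).
rewrite -/J in J1 J2.
have w4w : (4 * w)^-1 * w = 1 / 4 by field; rewrite gt_eqF.
have Jw : J%:R * w <= 1 / 4.
  by rewrite -w4w ler_pM2r.
have Jw8 : 1 / 8 <= J%:R * w.
  have : (4 * w)^-1 * w < J.+1%:R * w by rewrite ltr_pM2r.
  by rewrite w4w -[J.+1%:R]natr1 mulrDl; move: w8; clear; lra.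
have J0 : 0 < J%:R :> R by rewrite -(pmulr_lgt0 _ w0); lra.
apply: contrapT => fails.
have good (nu : probability R R) a b : 0 <= a <= 1 -> 0 <= b <= 1 ->
    cdf_of nu = hard_cdf a b -> ((2 / 3)%:E <= success P n price out nu e)%E.
  move=> a01 b01 Fnu; rewrite leNgt; apply/negP => lt23; apply: fails; exists nu.
  have [/andP[a0 _] /andP[b0 _]] := (a01, b01).
  by split; [exact: hard_supported Fnu|split=> //; rewrite Fnu; exact: hard_regular].
have h01 : 0 <= (1 / 2 : R) <= 1 by lra.
have w01 j : (j <= J)%N -> 0 <= 1 / 2 + j%:R * w <= 1.
  move=> jJ; have : j%:R * w <= J%:R * w by rewrite ler_pM2r// ler_nat.
  have : 0 <= j%:R * w by rewrite mulr_ge0// ltW.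
  by move: Jw; clear => ? ? ?; apply/andP; split; lra.
have [mu0 F0] := hard_probability h01 h01.
have /choice[mu F] : forall j, exists nu : probability R R, (j < J)%N ->
    cdf_of nu = hard_cdf (1 / 2 + j%:R * w) (1 / 2 + j.+1%:R * w).
  move=> j; have [jJ|_] := ltnP j J; last by exists mu0.
  by have [nu Fnu] := hard_probability (w01 _ (ltnW jJ)) (w01 _ jJ); exists nu.
pose B := J%:R * (1 + 1 / 6) + 3 / 4 * w ^+ 4 * n%:R.
have := @success_sum_le R d Omega P n J price out mu0 mu e B malg
  (fun om => windows_det_success n (price om) (out om) e0 e40 w0 we Jw F0 F).
have low : ((\sum_(j < J) (4 / 3 : R))%:E <=
    \sum_(j < J) (success P n price out mu0 e + success P n price out (mu j) e))%E.
  rewrite -sumEFin; apply: lee_sum => j _.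
  have -> : (4 / 3 : R) = 2 / 3 + 2 / 3 by field.
  rewrite EFinD; apply: leeD; first exact: good F0.
  exact: (good _ _ _ (w01 _ (ltnW (ltn_ord j))) (w01 _ (ltn_ord j)) (F _ (ltn_ord j))).
move=> /(le_trans low); rewrite lee_fin sumr_const card_ord -[_ *+ J]mulr_natl.
apply/negP; rewrite -ltNge /B.
have nw : 72 * (w ^+ 5 * n%:R) <= 1.
  have W5 : 0 < 72 * w ^+ 5 by rewrite mulr_gt0 ?exprn_gt0 ?ltr0n.
  have -> : 72 * (w ^+ 5 * n%:R) = 72 * w ^+ 5 * n%:R by ring.
  rewrite -ler_pdivlMl// mulr1; apply: le_trans nle _.
  by rewrite -invfM /w exprMn !mulrA.
have n8 : w * (w ^+ 4 * n%:R) = w ^+ 5 * n%:R by ring.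
(* After multiplication by w, success everywhere would require J w/6 <= (3/4) w^5 n, but the left
   side is at least 1/48 and the right side at most 1/96. *)
rewrite -(ltr_pM2l w0).
have -> : w * (J%:R * (1 + 1 / 6) + 3 / 4 * w ^+ 4 * n%:R) =
   J%:R * w * (7 / 6) + 3 / 4 * (w ^+ 5 * n%:R) by field.
have -> : w * (J%:R * (4 / 3)) = J%:R * w * (4 / 3) by ring.
by move: nw Jw8; clear; lra.
Qed.

Theorem theorem3 (R : realType) :
  (* Upper bound: O~(eps^{-5/2}) queries suffice, success prob >= 1 - eps. *)
  (exists (C : R) (k : nat), 0 < C /\
     forall eps : R, 0 < eps < 1 / 2 ->
       exists n : nat,
         n%:R <= C * (Num.sqrt eps ^+ 5)^-1 * ln (eps^-1) ^+ k /\
         exists (d : measure_display) (Omega : measurableType d)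
                (P : probability Omega R)
                (price : Omega -> seq bool -> R) (out : Omega -> seq bool -> R -> R),
           measurable_alg n price out /\
           forall mu : probability R R, supported01 mu -> regular (cdf_of mu) ->
             ((1 - eps)%:E <= success P n price out mu eps)%E) /\
  (* Lower bound: Omega(eps^{-5/2}) queries are necessary, even for success
     probability 2/3. *)
  (exists (c eps0 : R), 0 < c /\ 0 < eps0 /\
     forall eps : R, 0 < eps < eps0 ->
       forall n : nat, n%:R <= c * (Num.sqrt eps ^+ 5)^-1 ->
       forall (d : measure_display) (Omega : measurableType d)
              (P : probability Omega R)
              (price : Omega -> seq bool -> R) (out : Omega -> seq bool -> R -> R),
         measurable_alg n price out ->
         exists mu : probability R R, supported01 mu /\ regular (cdf_of mu) /\
           (success P n price out mu eps < (2 / 3)%:E)%E).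
Proof.
split; [exact: pricing_query_upper_bound|exact: pricing_query_lower_bound].
Qed.
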